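(* Let $\pi^0,\pi^1\in(0,1)$ with $\pi^0+\pi^1=1$, and let $T\ge1$. Restricting to the class of blockwise stationary (in particular, for $T=1$, stationary) designs of period $T$ consisting of binary, possibly randomized, quantizers, there exists an asymptotically optimal design each of whose quantizers is a deterministic likelihood ratio threshold rule.
   Context: $\mathbb P_0,\mathbb P_1$ are mutually absolutely continuous probability laws on a space $\mathcal X$ with densities $f^0,f^1$ with respect to a dominating measure. A deterministic binary quantizer is a measurable map $\phi:\mathcal X\to\mathcal U=\{0,1\}$; a randomized binary quantizer is a probability distribution over deterministic ones (drawn independently at each time step). Write $f_\phi^i(u)=\mathbb P_i(\phi(X)=u)$, $D_\phi^0:=D(f_\phi^0\|f_\phi^1)$, $D_\phi^1:=D(f_\phi^1\|f_\phi^0)$, with $D(p\|q)=\sum_u p(u)\log\frac{p(u)}{q(u)}$. Standing assumptions on the (non-empty) class $\Phi$ of quantizers considered: $D_\phi^0>0$, $D_\phi^1>0$ for all $\phi\in\Phi$, and $\sup_{\phi\in\Phi}\operatorname{Var}_{f_\phi^i}\log(f_\phi^1/f_\phi^0)<\infty$ for $i=0,1$; here $\Phi$ is the class of all binary randomized quantizers with positive divergences. A blockwise stationary design of period $T$ is a sequence of quantizers with $\phi_{n+T}=\phi_n$. With priors $\pi^0,\pi^1$ and cost per sample $c$, the optimal Bayes sequential cost (expected $c\times$sample size plus probability of error) of such a design behaves like $G\,c\log c^{-1}(1+o(1))$ as $c\to0$, where $$G=\frac{T\pi^0}{D^0_{\phi_1}+\dots+D^0_{\phi_T}}+\frac{T\pi^1}{D^1_{\phi_1}+\dots+D^1_{\phi_T}}.$$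 A design is asymptotically optimal in a class if it minimizes $G$ over that class. Likelihood ratio threshold rule (with $K=|\mathcal U|$; here $K=2$): a quantizer $\phi:\mathcal X\to\{0,\dots,K-1\}$ for which there are thresholds $d_0=-\infty<d_1<\dots<d_K=+\infty$ and a permutation $(u_1,\dots,u_K)$ of $(0,\dots,K-1)$ such that, with $\mathbb P_0$-probability 1, $\phi(X)=u_l$ if $d_{l-1}<f^1(X)/f^0(X)<d_l$ ($l=1,\dots,K$), and for each $l=2,\dots,K$, on the event $f^1(X)/f^0(X)=d_{l-1}$, either $\phi(X)=u_{l-1}$ with $\mathbb P_0$-probability 1 or $\phi(X)=u_l$ with $\mathbb P_0$-probability 1. *)

(* Defs.v *)
From HB Require Import structures.
From mathcomp Require Import all_boot all_order all_algebra perm.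
From mathcomp Require Import all_classical all_reals all_analysis.
From mathcomp Require Import measurable_realfun.

Set Implicit Arguments.
Unset Strict Implicit.
Unset Printing Implicit Defensive.

Import Order.TTheory GRing.Theory Num.Theory.

Local Open Scope classical_set_scope.
Local Open Scope ring_scope.

(* An alphabet of k.+1 letters {0, .., k} is 'I_k.+1, with its discrete
   sigma-algebra; binary quantizers take values in 'I_2. *)
HB.instance Definition _ (k : nat) := isPointed.Build 'I_k.+1 ord0.

HB.instance Definition _ (k : nat) :=
  @isMeasurable.Build default_measure_display 'I_k.+1
    discrete_measurable discrete_measurable0
    (@discrete_measurableC _) (@discrete_measurableU _).

HB.instance Definition _ d (X : measurableType d) (k : nat) :=
  isPointed.Build {mfun X >-> 'I_k.+1} (cst ord0 : {mfun X >-> 'I_k.+1}).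

Section laws.
Context {R : realType} {U : finType}.
Implicit Types p q : U -> R.

(* Real-valued, with ln 0 = 0 and x / 0 = 0: this agrees with the usual
   divergence (0 log (0 / 0) = 0) when p and q have the same support, which
   holds for the output laws below as P0 and P1 are mutually absolutely
   continuous. *)
Definition divergence p q : R := \sum_u p u * ln (p u / q u).

Definition expectation_of p (g : U -> R) : R := \sum_u p u * g u.

Definition variance_of p (g : U -> R) : R :=
  expectation_of p (fun u => (g u - expectation_of p g) ^+ 2).

End laws.

Section quantizers.
Context {d : measure_display} {X : measurableType d} {R : realType}.

Definition is_density (P : probability X R) (mu : {measure set X -> \bar R})
    (f : X -> R) : Prop :=
  [/\ measurable_fun setT f, (forall x, 0 <= f x) &
      forall A, measurable A -> P A = (\int[mu]_(x in A) (f x)%:E)%E].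

Definition det_law (P : probability X R) k (phi : {mfun X >-> 'I_k.+1})
    (u : 'I_k.+1) : \bar R :=
  P (phi @^-1` [set u]).

(* The deterministic quantizers carry the smallest sigma-algebra for which
   phi |-> P_i(phi(X) = u) is measurable for i = 0, 1 and every letter u.  This
   is the least restrictive choice: a distribution on any sigma-algebra for
   which the output laws of a randomized quantizer make sense restricts to this
   one, with the same output laws. *)
Definition law_events (P0 P1 : probability X R) k :
    set (set {mfun X >-> 'I_k.+1}) :=
  [set E | exists (P : probability X R) (u : 'I_k.+1) (B : set (\bar R)),
    [/\ P = P0 \/ P = P1, measurable B &
        E = (fun phi => det_law P phi u) @^-1` B]].

Definition det_quantizer (P0 P1 : probability X R) k :=
  g_sigma_algebraType (@law_events P0 P1 k).

Definition rand_quantizer (P0 P1 : probability X R) k :=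
  probability (det_quantizer P0 P1 k) R.

Definition deterministic (P0 P1 : probability X R) k
    (phi : {mfun X >-> 'I_k.+1}) : rand_quantizer P0 P1 k :=
  dirac (phi : det_quantizer P0 P1 k).

Section fixed_laws.
Context {P0 P1 : probability X R}.

(* P(q(X) = u) when the deterministic quantizer is drawn from q independently
   of X; used with P = P0 and P = P1. *)
Definition law (P : probability X R) k (q : rand_quantizer P0 P1 k)
    (u : 'I_k.+1) : R :=
  fine (\int[q]_phi det_law P (phi : {mfun X >-> 'I_k.+1}) u)%E.

Definition D0 k (q : rand_quantizer P0 P1 k) : R :=
  divergence (law P0 q) (law P1 q).

Definition D1 k (q : rand_quantizer P0 P1 k) : R :=
  divergence (law P1 q) (law P0 q).

Definition llr k (q : rand_quantizer P0 P1 k) (u : 'I_k.+1) : R :=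
  ln (law P1 q u / law P0 q u).

Definition llr_variance (P : probability X R) k (q : rand_quantizer P0 P1 k)
    : R :=
  variance_of (law P q) (llr q).

End fixed_laws.

Definition positive_divergences (P0 P1 : probability X R) k :
    set (rand_quantizer P0 P1 k) :=
  [set q | 0 < D0 q /\ 0 < D1 q].

Definition bounded_llr_variance (P0 P1 : probability X R) k
    (Phi : set (rand_quantizer P0 P1 k)) : Prop :=
  (ereal_sup [set (llr_variance P0 q)%:E | q in Phi] < +oo)%E /\
  (ereal_sup [set (llr_variance P1 q)%:E | q in Phi] < +oo)%E.

(* The quantizer used at the (n+1)-st time step is design n. *)
Definition blockwise_stationary (P0 P1 : probability X R) k
    (Phi : set (rand_quantizer P0 P1 k)) (T : nat) :
    set (nat -> rand_quantizer P0 P1 k) :=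
  [set design | (forall n, design (n + T)%N = design n) /\
                (forall n, Phi (design n))].

(* The constant in the asymptotic Bayes cost G c log (1/c) (1 + o(1)) as the
   cost c per sample goes to 0. *)
Definition cost_constant (P0 P1 : probability X R) k (pi0 pi1 : R) (T : nat)
    (design : nat -> rand_quantizer P0 P1 k) : R :=
  T%:R * pi0 / (\sum_(t < T) D0 (design t)) +
  T%:R * pi1 / (\sum_(t < T) D1 (design t)).

Definition asymptotically_optimal (P0 P1 : probability X R) k (pi0 pi1 : R)
    (T : nat) (C : set (nat -> rand_quantizer P0 P1 k))
    (design : nat -> rand_quantizer P0 P1 k) : Prop :=
  C design /\
  forall design', C design' ->
    cost_constant pi0 pi1 T design <= cost_constant pi0 pi1 T design'.

(* With K = k.+1 letters, only thr 0, .., thr K matter, and the l-th cell of the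
   likelihood ratio (l = 1, .., K) has index l - 1 : 'I_K here. *)
Definition likelihood_ratio_threshold_rule (P0 : probability X R)
    (f0 f1 : X -> R) k (phi : X -> 'I_k.+1) : Prop :=
  exists (thr : nat -> \bar R) (u : 'S_k.+1),
    [/\ thr 0 = -oo%E, thr k.+1 = +oo%E,
        (forall l, (l < k.+1)%N -> (thr l < thr l.+1)%E),
        (forall l : 'I_k.+1, {ae P0, forall x,
           (thr l < (f1 x / f0 x)%:E < thr l.+1)%E -> phi x = u l}) &
        (forall l l' : 'I_k.+1, l' = l.+1 :> nat ->
           {ae P0, forall x, (f1 x / f0 x)%:E = thr l' -> phi x = u l} \/
           {ae P0, forall x, (f1 x / f0 x)%:E = thr l' -> phi x = u l'})].

End quantizers.

Arguments positive_divergences {d X R} P0 P1 k.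

(* Main.v *)
Require Import Defs.
From HB Require Import structures.
From mathcomp Require Import all_boot all_order all_algebra perm.
From mathcomp Require Import all_classical all_reals all_analysis.
From mathcomp Require Import measurable_realfun.
From mathcomp Require Import ring lra.

Set Implicit Arguments.
Unset Strict Implicit.
Unset Printing Implicit Defensive.

Import Order.TTheory GRing.Theory Num.Theory.
Import numFieldNormedType.Exports.

Local Open Scope classical_set_scope.
Local Open Scope ring_scope.

(** The cost constant only depends on the pairs (a, b) of probabilities that
    the quantizers output a given letter, under P0 and under P1: with kl the
    binary divergence, the divergences are kl a b and kl b a.

    Exchanging the letters if necessary, a <= b.  By [neyman_pearson] the
    possible pairs then lie between the diagonal and the concave curve
    b = roc a, and both divergences increase with b; so it is enough to minimize
    the cost over the T-tuples of points of the curve ([dominated_by_gain]).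
    On the curve the divergences are continuous, and they vanish at its two
    ends because the variances of the log-likelihood ratio are bounded
    ([gain_small]).  Hence a minimum exists ([exists_minimal_cost]).

    The curve consists of the points given by the deterministic threshold rules
    lr > t and lr >= t, and of the segments of slope t that join two such points
    when lr = t has positive probability.  It remains to see that at a minimum
    no point is inside a segment ([minimal_at_threshold]).  With the other
    quantizers fixed, the cost is

      c0 / (d0 + D) + c1 / (d1 + E),    D := kl a b,  E := kl b a,

    with d0, d1 >= 0, and it has no local minimum inside a segment of positive
    slope that stays above the diagonal ([no_interior_minimum]).  This is not
    formal: 1 / D and 1 / E are quasi-concave, but a sum of quasi-concave
    functions need not be quasi-concave.  At a critical point the derivatives
    D' and E' have opposite signs, and the second derivative is negative if

      D'' / |D'| + E'' / |E'| > 2 (|D'| / D + |E'| / E)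

    ([critical_curvature]).  In the coordinates x := ln (b / a) and
    y := ln ((1 - a) / (1 - b)), with t the slope of the segment, put
    L := x + y, X := x - ln t and Y := y + ln t.  Then
    D' = expR Y - expR (- X) - L and D'' / D' > (expR Y + 1) / (1 - a), and
    there are similar formulas for E.  With these bounds, and after
    multiplication by expR X, the inequality is affine in expR X
    ([kl_line_gap]), so that it only has to be checked at the two points where
    D' or E' vanishes.  By symmetry this leaves one inequality in x and y
    ([bern_gap_bound]), about the function s / (expR s - 1). *)

(** * Inequalities for the exponential *)

Section exponential_inequalities.
Context {R : realType}.
Implicit Types a b r s x y L : R.

Lemma le_of_derive_ge0 (f df : R -> R) a b : a <= b ->
  (forall x, a <= x <= b -> is_derive x 1 f (df x)) ->
  (forall x, a <= x <= b -> 0 <= df x) -> f a <= f b.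
Proof.
move=> ab fdf df0.
have cf : {within `[a, b], continuous f}.
  have fd : {in `[a, b], forall x, derivable f x 1}.
    by move=> x; rewrite in_itv/= => xb; have [] := fdf x xb.
  exact: derivable_within_continuous fd.
have fdf' x : x \in `]a, b[ -> is_derive x 1 f (df x).
  rewrite in_itv/= => /andP[x0 xb]; apply: fdf.
  by rewrite (ltW x0) (ltW xb).
have [c] := MVT_segment ab fdf' cf.
rewrite in_itv/= => cb fE; rewrite -subr_ge0 fE mulr_ge0 ?df0//.
by rewrite subr_ge0.
Qed.

(** For x < 2 this is the Pade bound expR x <= (2 + x) / (2 - x). *)
Lemma expR_pade x : 0 <= x -> expR x * (2 - x) <= 2 + x.
Proof.
move=> x0.
have der1 s : is_derive s 1 (fun s : R => 1 + (s - 1) * expR s) (s * expR s).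
  by apply: is_derive_eq; rewrite /GRing.scale/=; ring.
have der s : is_derive s 1 (fun s : R => (s - 2) * expR s + s + 2)
    (1 + (s - 1) * expR s).
  by apply: is_derive_eq; rewrite /GRing.scale/=; ring.
have := @le_of_derive_ge0 _ _ 0 x x0 (fun s _ => der s).
rewrite expR0 => H.
suff : (0 - 2) * 1 + 0 + 2 <= (x - 2) * expR x + x + 2 by move=> ?; lra.
apply: H => s /andP[s0 _].
have := @le_of_derive_ge0 _ _ 0 s s0 (fun s _ => der1 s).
rewrite expR0 => H.
suff : 1 + (0 - 1) * 1 <= 1 + (s - 1) * expR s by move=> ?; lra.
by apply: H => r /andP[r0 _]; rewrite mulr_ge0 ?expR_ge0.
Qed.

Lemma expR1_le3 : expR 1 <= 3 :> R.
Proof. by have := @expR_pade 1 ler01; lra. Qed.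

(** The left-hand side is largest at s = 1, where it is e. *)
Lemma linear_expR_le3 s : (2 - s) * expR s <= 3.
Proof.
have h := expR_ge1Dx (1 - s).
have e3 := expR1_le3.
have -> : expR s = expR 1 / expR (1 - s).
  by rewrite -expRB; congr expR; ring.
have p := expR_gt0 (1 - s).
rewrite mulrA ler_pdivrMr//.
have := expR_gt0 (1 : R); nra.
Qed.

(** The second derivative of the difference is 6 - (2 - s) e^s, which is
    nonnegative by [linear_expR_le3]. *)
Lemma expR_le_quadratic_04 x : 0 <= x <= 4 ->
  (4 - x) * (expR x - 1) <= 3 * x ^+ 2 + 4 * x.
Proof.
move=> /andP[x0 x4].
have der1 s : is_derive s 1 (fun s : R => 6 * s + 3 - (3 - s) * expR s)
    (6 - (2 - s) * expR s).
  by apply: is_derive_eq; rewrite /GRing.scale/=; ring.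
have der s : is_derive s 1
    (fun s : R => 3 * s ^+ 2 + 4 * s - (4 - s) * (expR s - 1))
    (6 * s + 3 - (3 - s) * expR s).
  by apply: is_derive_eq; rewrite /GRing.scale/=; ring.
have := @le_of_derive_ge0 _ _ 0 x x0 (fun s _ => der s).
rewrite expR0 => H.
suff : 3 * 0 ^+ 2 + 4 * 0 - (4 - 0) * (1 - 1) <=
  3 * x ^+ 2 + 4 * x - (4 - x) * (expR x - 1) by move=> ?; lra.
apply: H => s /andP[s0 _].
have := @le_of_derive_ge0 _ _ 0 s s0 (fun s _ => der1 s).
rewrite expR0 => H.
suff : 6 * 0 + 3 - (3 - 0) * 1 <= 6 * s + 3 - (3 - s) * expR s.
  by move=> ?; lra.
apply: H => r _; have := linear_expR_le3 r; lra.
Qed.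

Lemma expR_le_quadratic_13 x : 1 <= x <= 3 ->
  (3 - x) * (expR x - 1) <= 6 * x ^+ 2 - 2 * x.
Proof.
move=> /andP[x1 x3].
have der s : is_derive s 1
    (fun s : R => 6 * s ^+ 2 - 2 * s - (3 - s) * (expR s - 1))
    (12 * s - 3 - (2 - s) * expR s).
  by apply: is_derive_eq; rewrite /GRing.scale/=; ring.
have H := @le_of_derive_ge0 _ _ 1 x x1 (fun s _ => der s).
suff : 0 <= 6 * x ^+ 2 - 2 * x - (3 - x) * (expR x - 1) by move=> ?; lra.
apply: le_trans (H _); first by have := expR1_le3; lra.
move=> s /andP[s1 _]; have := linear_expR_le3 s; lra.
Qed.

Lemma expRDexpRN_le r s : 0 <= r <= s ->
  expR r + expR (- r) <= expR s + expR (- s).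
Proof.
move=> /andP[r0 rs]; rewrite !expRN.
have er1 : 1 <= expR r by rewrite leNgt expR_lt1 -leNgt.
have ers : expR r <= expR s by rewrite ler_expR.
have er0 := expR_gt0 r; have es0 := expR_gt0 s.
rewrite -subr_ge0.
have -> : expR s + (expR s)^-1 - (expR r + (expR r)^-1) =
    (expR s - expR r) * (1 - (expR s * expR r)^-1).
  by field; rewrite !gt_eqF.
rewrite mulr_ge0 ?subr_ge0// invf_le1 ?mulr_gt0//; nra.
Qed.

(** Convexity of the hyperbolic sine on the half-line, in the form: the
    slope of its chords from 0 increases. *)
Lemma sinh_slope k s : 0 <= k <= 1 -> 0 <= s ->
  expR (k * s) - expR (- (k * s)) <= k * (expR s - expR (- s)).
Proof.
move=> /andP[k0 k1] s0.
have der r : is_derive r 1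
    (fun r : R => k * (expR r - expR (- r)) - (expR (k * r) - expR (- (k * r))))
    (k * (expR r + expR (- r) - (expR (k * r) + expR (- (k * r))))).
  by apply: is_derive_eq; rewrite /GRing.scale/=; ring.
have H := @le_of_derive_ge0 _ _ 0 s s0 (fun s _ => der s).
rewrite -subr_ge0; apply: le_trans (H _).
  by rewrite !(mulr0, oppr0, expR0) subrr mulr0 subrr.
move=> r /andP[r0 _]; rewrite mulr_ge0// subr_ge0 expRDexpRN_le//.
by rewrite mulr_ge0//= ler_piMl.
Qed.

Lemma lt_sinh s : 0 < s -> 2 * s < expR s - expR (- s).
Proof.
have weak r : 0 <= r -> 2 * r <= expR r - expR (- r).
  move=> r0.
  have der x : is_derive x 1 (fun x : R => expR x - expR (- x) - 2 * x)
      (expR x + expR (- x) - 2).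
    by apply: is_derive_eq; rewrite /GRing.scale/=; ring.
  have H := @le_of_derive_ge0 _ _ 0 r r0 (fun x _ => der x).
  rewrite -subr_ge0; apply: le_trans (H _).
    by rewrite mulr0 !(oppr0, expR0) !subrr.
  move=> x /andP[t0 _]; have := @expRDexpRN_le 0 x.
  by rewrite oppr0 expR0 lexx t0/= => /(_ isT); lra.
move=> s0; have := weak (s / 2).
have -> : expR s = expR (s / 2) * expR (s / 2) by rewrite -expRD; congr expR; lra.
have -> : expR (- s) = expR (- (s / 2)) * expR (- (s / 2)).
  by rewrite -expRD; congr expR; lra.
have e1 : 1 < expR (s / 2) by rewrite expR_gt1; lra.
rewrite expRN; set e := expR (s / 2) in e1 *.
have ei : e * e^-1 = 1 by rewrite divff// gt_eqF//; lra.
have ei0 : 0 < e^-1 by rewrite invr_gt0; lra.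
have -> : e * e - e^-1 * e^-1 = (e - e^-1) * (e + e^-1) by ring.
have e2 : 2 < e + e^-1.
  have -> : e + e^-1 = 2 + (e - 1) ^+ 2 / e by field; rewrite gt_eqF//; lra.
  by rewrite ltrDl divr_gt0 ?exprn_gt0//; lra.
move: e2; set A := e + e^-1; set B := e - e^-1 => e2 h.
have {}h : s <= B by have := h _; lra.
nra.
Qed.

End exponential_inequalities.

(** * The Bernoulli function and the gap inequality *)

Section bernoulli_function.
Context {R : realType}.
Implicit Types s x y L : R.

(** The generating function of the Bernoulli numbers. *)
Definition bern x : R := x / (expR x - 1).

Lemma expRB1_gt0 x : 0 < x -> 0 < expR x - 1.
Proof. by move=> x0; rewrite subr_gt0 expR_gt1. Qed.

Lemma bern_gt0 x : 0 < x -> 0 < bern x.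
Proof. by move=> x0; rewrite divr_gt0// expRB1_gt0. Qed.

Lemma bern_le1 x : 0 < x -> bern x <= 1.
Proof.
move=> x0; rewrite ler_pdivrMr ?expRB1_gt0// mul1r.
by have := expR_ge1Dx x; lra.
Qed.

Lemma bern_nonincreasing x y : 0 < x <= y -> bern y <= bern x.
Proof.
move=> /andP[x0 xy]; have y0 : 0 < y by lra.
have k0 : 0 <= x / y by rewrite divr_ge0// ltW.
have k1 : x / y <= 1 by rewrite ler_pdivrMr// mul1r.
have der s : is_derive s 1
    (fun s : R => x / y * (expR s - 1) - (expR (x / y * s) - 1))
    (x / y * (expR s - expR (x / y * s))).
  by apply: is_derive_eq; rewrite /GRing.scale/=; ring.
have H := @le_of_derive_ge0 _ _ _ 0 y (ltW y0) (fun s _ => der s).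
have {}H : 0 <= x / y * (expR y - 1) - (expR (x / y * y) - 1).
  apply: le_trans (H _); first by rewrite mulr0 expR0 !subrr mulr0 subrr.
  move=> s /andP[s0 _]; rewrite mulr_ge0// subr_ge0 ler_expR.
  by rewrite ler_piMl.
move: H; rewrite divfK ?gt_eqF// subr_ge0 => H.
rewrite /bern ler_pdivlMr ?expRB1_gt0// mulrAC ler_pdivrMr ?expRB1_gt0//.
by move: H; rewrite mulrAC ler_pdivlMr// mulrC.
Qed.

(** The even part (x / 2) coth (x / 2) of bern increases; multiplied out, this
    says that sinh ((y - x) / 2) / (y - x) <= sinh ((x + y) / 2) / (x + y). *)
Lemma even_bern_nondecreasing x y : 0 < x <= y ->
  bern x + x / 2 <= bern y + y / 2.
Proof.
move=> /andP[x0 xy]; have y0 : 0 < y by lra.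
have px := expRB1_gt0 x0; have py := expRB1_gt0 y0.
have L0 : 0 < x + y by lra.
have := @sinh_slope _ ((y - x) / (x + y)) ((x + y) / 2).
rewrite ler_pdivlMr// mul0r ler_pdivrMr// mul1r.
have -> : (y - x) / (x + y) * ((x + y) / 2) = (y - x) / 2.
  by field; rewrite gt_eqF.
have -> : 0 <= y - x <= x + y by apply/andP; split; lra.
have -> : 0 <= (x + y) / 2 by lra.
move=> /(_ isT isT) H.
have {}H : (expR y - expR x) * (x + y) <= (y - x) * (expR x * expR y - 1).
  rewrite -[X in X <= _]mulrC.
  have -> : expR y = expR ((y - x) / 2) * expR ((x + y) / 2).
    by rewrite -expRD; congr expR; lra.
  have -> : expR x = expR (- ((y - x) / 2)) * expR ((x + y) / 2).
    by rewrite -expRD; congr expR; lra.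
  have : 0 < expR ((x + y) / 2) by rewrite expR_gt0.
  have : expR ((x + y) / 2) * expR (- ((x + y) / 2)) = 1.
    by rewrite -expRD subrr expR0.
  have : expR ((y - x) / 2) * expR (- ((y - x) / 2)) = 1.
    by rewrite -expRD subrr expR0.
  move: H; set c := expR ((x + y) / 2); set c' := expR (- _).
  set d := expR ((y - x) / 2); set d' := expR (- ((y - x) / 2)).
  rewrite mulrAC ler_pdivlMr// => H dd cc c0.
  have -> : d' * c * (d * c) - 1 = c * (c - c').
    have -> : d' * c * (d * c) = (d * d') * (c * c) by ring.
    by rewrite dd mulrBr cc mul1r.
  have := ler_wpM2l (ltW c0) H; lra.
rewrite -subr_ge0.
have -> : bern y + y / 2 - (bern x + x / 2) =
   ((y - x) * (expR x * expR y - 1) - (expR y - expR x) * (x + y)) /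
   (2 * (expR x - 1) * (expR y - 1)).
  by rewrite /bern; field; rewrite !gt_eqF.
by rewrite divr_ge0 ?subr_ge0// mulr_ge0 ?ltW//; lra.
Qed.

Lemma even_bern_ge1 x : 0 < x -> 1 <= bern x + x / 2.
Proof.
move=> x0; have px := expRB1_gt0 x0.
rewrite -lerBlDr /bern ler_pdivlMr//.
by have := expR_pade (ltW x0); lra.
Qed.

(** What remains of [bern_gap_bound] for y <= x once the gap z := y + bern y -
    bern x is replaced by its greatest lower bound 1 - bern L, approached as y
    tends to 0. *)
Lemma bern_bound L : 0 < L ->
  (1 + bern L) * (1 - expR (- L) - (1 - bern L) * L / 3) <= 2 * L * bern L.
Proof.
move=> L0; have u0 := expRB1_gt0 L0; have b0 := bern_gt0 L0.
have b1 := bern_le1 L0.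
have [L3|L3] := leP 3 L.
  have := expR_gt0 (- L); set B := bern L in b0 b1 * => e0.
  have : (1 - B) * 3 <= (1 - B) * L by apply: ler_wpM2l => //; lra.
  have : B * 3 <= B * L by apply: ler_wpM2l => //; lra.
  nra.
have -> : expR (- L) = (expR L)^-1 by rewrite expRN.
rewrite /bern; set u := expR L - 1 in u0 *.
have -> : expR L = 1 + u by rewrite /u; lra.
have uL : L <= u by have := expR_ge1Dx L; rewrite /u; lra.
rewrite -subr_ge0.
have -> : 2 * L * (L / u) - (1 + L / u) * (1 - (1 + u)^-1 - (1 - L / u) * L / 3)
  = (6 * L ^+ 2 * u * (1 + u) -
     (u + L) * (3 * u ^+ 2 - (u - L) * L * (1 + u))) / (3 * u ^+ 2 * (1 + u)).
  by field; rewrite !gt_eqF//; lra.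
rewrite divr_ge0//; last by rewrite !mulr_ge0 ?exprn_ge0//; lra.
have [L1|L1] := leP L 1.
  have h : u * (2 - L) <= 2 * L.
    by have := expR_pade (ltW L0); rewrite /u; lra.
  have u2 : u <= 2 * L by nra.
  have -> : 6 * L ^+ 2 * u * (1 + u) -
     (u + L) * (3 * u ^+ 2 - (u - L) * L * (1 + u)) =
     3 * u * (2 * L ^+ 2 * (1 + u) - u * (u + L)) +
     (u + L) * (u - L) * L * (1 + u) by ring.
  rewrite addr_ge0//; last by rewrite !mulr_ge0//; lra.
  rewrite mulr_ge0//; first by lra.
  have : 0 <= (2 * L - u * (2 - L)) * (u + 2 * L) by rewrite mulr_ge0//; lra.
  have : 0 <= (2 * L - u) * L * u by rewrite !mulr_ge0//; lra.
  nra.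
have h : (3 - L) * u <= 6 * L ^+ 2 - 2 * L.
  by apply: expR_le_quadratic_13; lra.
have -> : 6 * L ^+ 2 * u * (1 + u) -
     (u + L) * (3 * u ^+ 2 - (u - L) * L * (1 + u)) =
  u ^+ 2 * (6 * L ^+ 2 - 2 * L - (3 - L) * u) + L ^+ 2 * (6 - L) * u - L ^+ 3
  by ring.
have : 0 <= u ^+ 2 * (6 * L ^+ 2 - 2 * L - (3 - L) * u).
  by rewrite mulr_ge0 ?exprn_ge0//; lra.
have : L ^+ 3 <= L ^+ 2 * (6 - L) * u.
  rewrite exprSr -mulrA ler_wpM2l ?exprn_ge0//; first by lra.
  by nra.
lra.
Qed.

(** This is the inequality of [kl_line_gap] at v1, where kl b a is stationary;
    exchanging x and y gives it at v2.  The gap z := y + bern y - bern x is half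
    the sum L plus the increment from x to y of the even part of bern.  If
    x <= y then z >= L / 2 is enough.  If y <= x then y <= z and
    1 - bern L <= z, and the term in expR x = expR L * expR (- y) compensates
    for z < 2, because expR (- y) >= expR (- z) >= (2 - z) / 3. *)
Lemma bern_gap_bound x y (L := x + y) : 0 < x -> 0 < y ->
  2 * (expR L - 1 - L ^+ 2 * expR L / (expR L - 1)) <=
  (y + bern y - bern x) * (expR L - 1 + L * expR x).
Proof.
move=> x0 y0; have L0 : 0 < L by rewrite /L; lra.
have u0 := expRB1_gt0 L0; set u := expR L - 1 in u0 *.
have ex1 : 1 < expR x by rewrite expR_gt1.
have uE : expR L = u + 1 by rewrite /u; lra.
have [xy|yx] := leP x y.
  have z : L / 2 <= y + bern y - bern x.
    by have := @even_bern_nondecreasing x y; rewrite x0 xy => /(_ isT);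
      rewrite /L; lra.
  have Le : 0 <= u + L * expR x by rewrite addr_ge0// ?mulr_ge0//; lra.
  apply: le_trans (ler_wpM2r Le z).
  have : L / 2 * (u + L) <= L / 2 * (u + L * expR x).
    by rewrite ler_wpM2l ?lerD2l ?ler_peMr//; lra.
  apply: le_trans.
  have c1 : L + 2 * bern L >= 2 by have := even_bern_ge1 L0; lra.
  have -> : L ^+ 2 * expR L / u = L ^+ 2 + L * bern L.
    by rewrite uE /bern -/u; field; rewrite gt_eqF.
  have [L4|L4] := leP 4 L; last first.
    have := @expR_le_quadratic_04 _ L; rewrite (ltW L0) (ltW L4) => /(_ isT).
    by rewrite -/u; nra.
  have : 4 * u <= L * u by rewrite ler_wpM2r//; lra.
  by nra.
set z := y + bern y - bern x.
have zy : y <= z.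
  have := @bern_nonincreasing y x; rewrite y0 ltW// => /(_ isT).
  by rewrite /z; lra.
have zB : 1 - bern L <= z.
  have := even_bern_ge1 y0.
  have xL : 0 < x <= L by rewrite /L; lra.
  have := even_bern_nondecreasing xL; rewrite {2 3}/L.
  by rewrite /z; lra.
have E0 := expR_gt0 L.
rewrite -(@ler_pM2r _ (expR (- L))) ?expR_gt0//.
have -> : 2 * (u - L ^+ 2 * expR L / u) * expR (- L) =
  2 * (1 - expR (- L)) - 2 * L * bern L.
  rewrite expRN /bern -/u uE; field; rewrite !gt_eqF//; lra.
have -> : z * (u + L * expR x) * expR (- L) =
    z * (1 - expR (- L)) + z * L * expR (- y).
  have -> : expR (- y) = expR x * expR (- L).
    by rewrite -expRD; congr expR; rewrite /L; lra.
  by rewrite expRN uE; field; rewrite gt_eqF//; lra.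
have w0 : 0 < expR (- L) < 1 by rewrite expR_gt0 expR_lt1; lra.
set w := 1 - expR (- L).
have {}w0 : 0 < w < 1 by rewrite /w; lra.
have b0 := bern_gt0 L0; have b1 := bern_le1 L0.
have ey := expR_gt0 (- y).
have zLe : 0 <= z * L * expR (- y) by rewrite !mulr_ge0//; lra.
have LB : 0 <= L * bern L by rewrite mulr_ge0// ltW.
have [z2|z2] := leP 2 z.
  have : 2 * w <= z * w by rewrite ler_wpM2r//; lra.
  by lra.
have ez : (2 - z) / 3 <= expR (- y).
  apply: (@le_trans _ _ (expR (- z))); last by rewrite ler_expR; lra.
  rewrite expRN -[X in _ <= X]mul1r ler_pdivlMr ?expR_gt0//.
  by have := linear_expR_le3 z; lra.
have := bern_bound L0; rewrite -/w => h.
have {}ez : (2 - z) * (z * L / 3) <= z * L * expR (- y).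
  have -> : (2 - z) * (z * L / 3) = z * L * ((2 - z) / 3) by ring.
  by rewrite ler_wpM2l// mulr_ge0//; lra.
have {}h : (2 - z) * (w - z * L / 3) <= 2 * L * bern L.
  have [zL|zL] := leP w (z * L / 3).
    have : (2 - z) * (w - z * L / 3) <= 0 by rewrite pmulr_rle0; lra.
    by lra.
  apply: le_trans h; apply: ler_pM; [lra|lra|lra|].
  have : (1 - bern L) * L <= z * L by rewrite ler_wpM2r//; lra.
  by lra.
by move: h ez; lra.
Qed.

End bernoulli_function.

(** * The binary divergence along a line *)

Section binary_divergence.
Context {R : realType}.
Implicit Types a b s t x y L X Y : R.

(** The divergence of the Bernoulli law of parameter a from that of parameter
    b. *)
Definition kl a b : R := a * ln (a / b) + (1 - a) * ln ((1 - a) / (1 - b)).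

(** This is the square of L / 2 < sinh (L / 2). *)
Lemma chord_gap_gt0 L : 0 < L -> L ^+ 2 * expR L < (expR L - 1) ^+ 2.
Proof.
move=> L0; have L20 : 0 < L / 2 by lra.
have := lt_sinh L20; rewrite expRN.
have -> : expR L = expR (L / 2) ^+ 2.
  by rewrite expr2 -expRD; congr expR; lra.
set c := expR (L / 2); have c0 : 0 < c by exact: expR_gt0.
have -> : c - c^-1 = (c ^+ 2 - 1) / c by field; rewrite gt_eqF.
rewrite ltr_pdivlMr// => h.
rewrite -exprMn ltr_pXn2r// ?nnegrE; [nra|by rewrite mulr_ge0// ltW|nra].
Qed.

(** In the coordinates of [kl_line_gap], the slope expR Y - expR (- X) -
    (X + Y) is less than expR Y - 1 - Y, which the Pade bound compares with
    (expR Y - 1)^2. *)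
Lemma slope_lt_curvature X Y : 0 < X -> 0 < Y ->
  (expR Y + 1) * (expR Y - expR (- X) - (X + Y)) < (expR Y - 1) ^+ 2.
Proof.
move=> X0 Y0; have h := expR_pade (ltW Y0).
have h2 : 1 - X < expR (- X) by apply: expR_gt1Dx; lra.
have : (expR Y + 1) * (expR Y - expR (- X) - (X + Y)) <
       (expR Y + 1) * (expR Y - 1 - Y).
  by rewrite ltr_pM2l; [lra|have := expR_gt0 Y; lra].
by move=> /lt_le_trans; apply; nra.
Qed.

(** For fixed L, the slope increases with X and is negative at X = 0. *)
Lemma slope_gt0_arg X Y (L := X + Y) : 0 < L ->
  0 < expR X - expR (- Y) - L -> 0 < X.
Proof.
move=> L0; have -> : expR (- Y) = expR X * expR (- L).
  by rewrite -expRD; congr expR; rewrite /L; lra.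
have e := expR_ge1Dx (- L); have eL := expR_gt0 (- L); have eX := expR_gt0 X.
move=> h; rewrite -expR_gt1.
have el1 : expR (- L) < 1 by rewrite expR_lt1; lra.
nra.
Qed.

(** Along the direction (1, t) at (a, b), the derivatives of kl a b and
    kl b a are d1 and - t e1.  With v := expR X as unknown and x, y fixed, both
    sides multiplied by v are affine in v.  The slopes d1 and e1 vanish
    respectively at v2 := (expR L - 1) / L and v1 := L / (1 - expR (- L)), and
    d1 and e1 are both positive exactly when v1 < v < v2.  So it suffices to
    bound 1 / kl a b and 1 / kl b a in such a way that equality holds at v1
    and at v2; this is what [bern_gap_bound] does, used at (x, y) and at
    (y, x). *)
Lemma kl_line_gap a b t (x := ln (b / a)) (y := ln ((1 - a) / (1 - b)))
    (X := x - ln t) (Y := y + ln t) (L := x + y)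
    (d1 := expR Y - expR (- X) - L) (e1 := expR X - expR (- Y) - L) :
  0 < a -> a < b -> b < 1 -> 0 < t -> 0 < d1 -> 0 < e1 ->
  2 * (d1 / kl a b + t * e1 / kl b a) <=
  (expR Y + 1) / (1 - a) + t * (expR X + 1) / b.
Proof.
move=> a0 ab b1 t0.
have b0 : 0 < b by lra.
have a1 : 0 < 1 - a by lra.
have b1' : 0 < 1 - b by lra.
have x0 : 0 < x by rewrite /x ln_gt0// ltr_pdivlMr// mul1r.
have y0 : 0 < y by rewrite /y ln_gt0// ltr_pdivlMr//; lra.
have eX : expR X = b / a / t by rewrite /X expRB !lnK// ?posrE// ?divr_gt0.
have eY : expR Y = (1 - a) / (1 - b) * t.
  by rewrite /Y expRD !lnK// ?posrE// ?divr_gt0.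
set A := expR x; set B := expR y.
have A1 : 1 < A by rewrite expR_gt1.
have B1 : 1 < B by rewrite expR_gt1.
have AE : A = b / a by rewrite /A lnK// posrE divr_gt0.
have BE : B = (1 - a) / (1 - b) by rewrite /B lnK// posrE divr_gt0//.
have L0 : 0 < L by rewrite /L; lra.
have LE : expR L = A * B by rewrite expRD.
set v := expR X; have v0 : 0 < v by exact: expR_gt0.
have AB1 : 0 < A * B - 1 by nra.
have tE : t = A / v by rewrite /v eX AE; field; rewrite !gt_eqF.
have YE : expR Y = A * B / v.
  by rewrite eY AE BE /v eX; field; rewrite !gt_eqF.
(* The point (a, b) is recovered from the likelihood ratios A and 1 / B of
   its two letters. *)
have aE : a = (B - 1) / (A * B - 1).
  rewrite AE BE; field; rewrite !gt_eqF//=; lra.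
have bE : b = A * (B - 1) / (A * B - 1).
  by rewrite -mulrA -aE AE divfK ?gt_eqF.
set z := y + bern y - bern x; set z' := x + bern x - bern y.
have klE : kl a b = (A - 1) * (B - 1) * z / (A * B - 1).
  rewrite /kl -invf_div lnV ?posrE ?divr_gt0// -/x -/y /z /bern -/A -/B.
  by rewrite aE; field; rewrite !gt_eqF//; lra.
have klE' : kl b a = (A - 1) * (B - 1) * z' / (A * B - 1).
  rewrite /kl -(invf_div (1 - a)) lnV ?posrE ?divr_gt0// -/x -/y /z' /bern -/A -/B.
  by rewrite bE; field; rewrite !gt_eqF//; lra.
have gz := bern_gap_bound x0 y0; have gz' := bern_gap_bound y0 x0.
rewrite -/z -/z' (addrC y x) -/L -/A -/B LE in gz gz'.
have := chord_gap_gt0 L0; rewrite LE.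
set u := A * B - 1 in AB1 gz gz' klE klE' aE bE *.
have ABE : A * B = u + 1 by rewrite /u; lra.
move=> K0.
set K := u - L ^+ 2 * (A * B) / u in gz gz'.
have {}K0 : 0 < K.
  have -> : K = (u ^+ 2 - L ^+ 2 * (A * B)) / u by rewrite /K; field; rewrite gt_eqF.
  by rewrite divr_gt0// subr_gt0.
have f0 : 0 < u + L * A by nra.
have f0' : 0 < u + L * B by nra.
have z0 : 0 < z by rewrite -(pmulr_lgt0 _ f0); lra.
have z'0 : 0 < z' by rewrite -(pmulr_lgt0 _ f0'); lra.
have d1E : d1 = (u - L * v) / v.
  by rewrite /d1 YE expRN -/v /u; field; rewrite gt_eqF.
have e1E : e1 = v * u / (A * B) - L.
  by rewrite /e1 expRN YE -/v /u; field; rewrite !gt_eqF//; lra.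
move=> d10 e10.
have iz : z^-1 <= (u + L * A) / (2 * K).
  by rewrite ler_pdivlMr ?mulr_gt0// [z^-1 * _]mulrC ler_pdivrMr// [leRHS]mulrC.
have iz' : z'^-1 <= (u + L * B) / (2 * K).
  by rewrite ler_pdivlMr ?mulr_gt0// [z'^-1 * _]mulrC ler_pdivrMr// [leRHS]mulrC.
have AB0 : 0 < (A - 1) * (B - 1) by rewrite mulr_gt0//; lra.
apply: (@le_trans _ _ (2 * (u / ((A - 1) * (B - 1))) *
   (d1 * ((u + L * A) / (2 * K)) + t * e1 * ((u + L * B) / (2 * K))))).
  have -> : 2 * (d1 / kl a b + t * e1 / kl b a) =
    2 * (u / ((A - 1) * (B - 1))) * (d1 * z^-1 + t * e1 * z'^-1).
    rewrite klE klE'; field; rewrite !gt_eqF//; lra.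
  apply: ler_wpM2l; first by rewrite ltW// mulr_gt0// divr_gt0.
  by apply: lerD; apply: ler_wpM2l => //; rewrite ltW// mulr_gt0.
have A10 : 0 < A - 1 by lra.
have B10 : 0 < B - 1 by lra.
(* The two sides now agree, being affine in v and equal at v1 and v2. *)
rewrite le_eqVlt; apply/orP; left; apply/eqP.
have -> : 1 - a = B * (A - 1) / u by rewrite aE /u; field; rewrite gt_eqF.
have u2 : 0 < u ^+ 2 - L ^+ 2 * (A * B).
  move: K0; rewrite /K.
  have -> : u - L ^+ 2 * (A * B) / u = (u ^+ 2 - L ^+ 2 * (A * B)) / u.
    by field; rewrite gt_eqF.
  by rewrite pmulr_lgt0 // invr_gt0.
rewrite d1E e1E YE tE bE /K.
move: u2; rewrite /u => u2.
field; rewrite !gt_eqF//; lra.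
Qed.

End binary_divergence.

(** * Second-order conditions along a line *)

Section second_derivative.
Context {R : realType}.
Implicit Types a b s t x y h e : R.

(** Were f2 negative, f1 would be negative just after 0 and f decreasing. *)
Lemma second_derivative_test (f f1 : R -> R) (f2 e : R) : 0 < e ->
  (forall h, `|h| < e -> is_derive h 1 f (f1 h)) -> is_derive (0 : R) 1 f1 f2 ->
  (forall h, `|h| < e -> f 0 <= f h) -> f1 0 = 0 /\ 0 <= f2.
Proof.
move=> e0 df df1 fmin.
have itv h : h \in `]- e, e[ = (`|h| < e) by rewrite in_itv/= ltr_norml.
have f10 : f1 0 = 0.
  have : is_derive (0 : R) 1 f 0.
    apply: (@derive1_at_min _ f (- e) e); first by lra.
    - by move=> t; rewrite itv => /df [].
    - by rewrite itv normr0.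
    - by move=> t; rewrite itv; exact: fmin.
  move=> /@derive_val d0; have := df 0; rewrite normr0 => /(_ e0).
  by move=> /@derive_val d1; rewrite -d1 d0.
split => //; rewrite leNgt; apply/negP => f2n.
have : (fun h : R => h^-1 *: (f1 (h *: 1 + 0) - f1 0)) @ 0^' --> f2.
  have [d <-] := df1; exact: d.
move=> /cvgr_lt/(_ _ f2n)[d /= d0 Hd].
pose h := Num.min (d / 2) (e / 2).
have h0 : 0 < h by rewrite lt_min !divr_gt0.
have hd : h < d by rewrite gt_min; apply/orP; left; lra.
have he : h < e by rewrite gt_min; apply/orP; right; lra.
have dfh x : x \in `]0, h[ -> is_derive x 1 f (f1 x).
  by rewrite in_itv/= => /andP[x0 xh]; apply: df; rewrite gtr0_norm//; lra.
have cf : {within `[0, h], continuous f}.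
  have fd : {in `[0, h], forall x, derivable f x 1}.
    move=> x; rewrite in_itv/= => /andP[x0 xh].
    have : `|x| < e by rewrite ger0_norm//; lra.
    by move=> /df[].
  exact: derivable_within_continuous fd.
have [c] := MVT h0 dfh cf; rewrite in_itv/= => /andP[c0 ch] fE.
have := Hd c; rewrite /ball_/= sub0r normrN gtr0_norm// => /(_ _ _).
have cd : c < d by lra.
move=> /(_ cd (lt0r_neq0 c0)); rewrite /GRing.scale/= mulr1 addr0 f10 subr0.
rewrite pmulr_rlt0 ?invr_gt0// => f1c.
have := fmin h; rewrite gtr0_norm// => /(_ he).
by rewrite -subr_ge0 fE subr0 pmulr_lge0//; lra.
Qed.

Lemma is_derive_ln_ratio (f g : R -> R) (x df dg : R) : 0 < f x -> 0 < g x ->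
  is_derive x 1 f df -> is_derive x 1 g dg ->
  is_derive x 1 (fun t => ln (f t / g t)) (df / f x - dg / g x).
Proof.
move=> f0 g0 dfx dgx.
have gn0 : g x != 0 by rewrite gt_eqF.
have dV := is_deriveV gn0 dgx.
have dq : is_derive x 1 (fun t => f t / g t) (df / g x - f x * dg / g x ^+ 2).
  apply: (@is_derive_eq _ _ _ _ _ _ _ _ (is_deriveM _ _)).
  by rewrite /GRing.scale/=; field.
have q0 : 0 < f x / g x by rewrite divr_gt0.
have -> : df / f x - dg / g x =
    (f x / g x)^-1 * (df / g x - f x * dg / g x ^+ 2).
  by field; rewrite !gt_eqF.
exact: (@is_derive1_comp _ (@ln R) (fun t => f t / g t) _ _ _ (is_derive1_ln q0) dq).
Qed.

(** The divergence along the line through (a, b) of direction (al, be): the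
    derivative is needed near (a, b), the second derivative only at it. *)
Section line.
Variables (a b al be : R).
Let A (h : R) := a + al * h.
Let B (h : R) := b + be * h.

Definition kl_slope h : R :=
  al * (ln (A h / B h) - ln ((1 - A h) / (1 - B h))) +
  be * ((1 - A h) / (1 - B h) - A h / B h).

Definition kl_curvature : R :=
  (al - be * a / b) ^+ 2 / a + (al - be * (1 - a) / (1 - b)) ^+ 2 / (1 - a).

Lemma is_derive_kl h : 0 < A h < 1 -> 0 < B h < 1 ->
  is_derive h 1 (fun h => kl (A h) (B h)) (kl_slope h).
Proof.
move=> /andP[A0 A1] /andP[B0 B1].
have A1' : 0 < 1 - A h by lra.
have B1' : 0 < 1 - B h by lra.
have dA : is_derive h 1 A al.
  by apply: is_derive_eq; rewrite /GRing.scale/=; ring.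
have dB : is_derive h 1 B be.
  by apply: is_derive_eq; rewrite /GRing.scale/=; ring.
have dA' : is_derive h 1 (fun h => 1 - A h) (- al).
  by apply: is_derive_eq; rewrite /GRing.scale/=; ring.
have dB' : is_derive h 1 (fun h => 1 - B h) (- be).
  by apply: is_derive_eq; rewrite /GRing.scale/=; ring.
have d1 := is_derive_ln_ratio A0 B0 dA dB.
have d2 := @is_derive_ln_ratio (fun h => 1 - A h) (fun h => 1 - B h)
  h _ _ A1' B1' dA' dB'.
apply: (@is_derive_eq _ _ _ _ _ _ _ _
  (is_deriveD (is_deriveM dA d1) (is_deriveM dA' d2))).
rewrite /kl_slope /GRing.scale/=; field; rewrite !gt_eqF//.
Qed.

Lemma is_derive_kl_slope : 0 < a < 1 -> 0 < b < 1 ->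
  is_derive (0 : R) 1 kl_slope kl_curvature.
Proof.
move=> /andP[a0 a1] /andP[b0 b1].
have AE : A 0 = a by rewrite /A mulr0 addr0.
have BE : B 0 = b by rewrite /B mulr0 addr0.
have A0 : 0 < A 0 by rewrite AE.
have B0 : 0 < B 0 by rewrite BE.
have A1' : 0 < 1 - A 0 by rewrite AE; lra.
have B1' : 0 < 1 - B 0 by rewrite BE; lra.
have dA : is_derive (0 : R) 1 A al.
  by apply: is_derive_eq; rewrite /GRing.scale/=; ring.
have dB : is_derive (0 : R) 1 B be.
  by apply: is_derive_eq; rewrite /GRing.scale/=; ring.
have dA' : is_derive (0 : R) 1 (fun h => 1 - A h) (- al).
  by apply: is_derive_eq; rewrite /GRing.scale/=; ring.
have dB' : is_derive (0 : R) 1 (fun h => 1 - B h) (- be).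
  by apply: is_derive_eq; rewrite /GRing.scale/=; ring.
have d1 := is_derive_ln_ratio A0 B0 dA dB.
have d2 := @is_derive_ln_ratio (fun h => 1 - A h) (fun h => 1 - B h)
  0 _ _ A1' B1' dA' dB'.
have nB : B 0 != 0 by rewrite gt_eqF.
have nB' : 1 - B 0 != 0 by rewrite gt_eqF.
have d3 := is_deriveM dA (is_deriveV nB dB).
have d4 := is_deriveM dA' (@is_deriveV _ (fun h => 1 - B h) _ _ _ nB' dB').
have d5 := is_deriveD (is_deriveZ al (is_deriveB d1 d2))
  (is_deriveZ be (is_deriveB d4 d3)).
apply: (@is_derive_eq _ _ _ _ _ _ _ _ d5).
rewrite /kl_curvature /GRing.scale/= AE BE; field; rewrite !gt_eqF//; lra.
Qed.

End line.
End second_derivative.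

(** * Monotonicity of the binary divergence *)

Section divergence_order.
Context {R : realType}.
Implicit Types a b c s t x y h e : R.

Lemma ln_ltB1 x : 0 < x -> x != 1 -> ln x < x - 1.
Proof.
move=> x0 x1; have : ln x != 0 by rewrite ln_eq0.
by move=> /expR_gt1Dx; rewrite lnK ?posrE//; lra.
Qed.

Lemma ln_leB1 x : 0 < x -> ln x <= x - 1.
Proof.
move=> x0; have [->|x1] := eqVneq x 1; first by rewrite ln1 subrr.
by rewrite ltW// ln_ltB1.
Qed.

Lemma ln_ratioN x y : 0 < x -> 0 < y -> ln (x / y) = - ln (y / x).
Proof. by move=> x0 y0; rewrite -invf_div lnV ?posrE ?divr_gt0. Qed.

Lemma kl_gt0 a b : 0 < a < 1 -> 0 < b < 1 -> a != b -> 0 < kl a b.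
Proof.
move=> /andP[a0 a1] /andP[b0 b1] ab.
have a1' : 0 < 1 - a by lra.
have b1' : 0 < 1 - b by lra.
rewrite /kl ln_ratioN// (ln_ratioN a1' b1') !mulrN.
have n1 : b / a != 1.
  by apply: contra_neq ab => h; rewrite -[b](divfK (lt0r_neq0 a0)) h mul1r.
have := ln_ltB1 (divr_gt0 b0 a0) n1.
have := ln_leB1 (divr_gt0 b1' a1').
rewrite -(ler_pM2l a1') -(ltr_pM2l a0).
have -> : a * (b / a - 1) = b - a by field; rewrite gt_eqF.
have -> : (1 - a) * ((1 - b) / (1 - a) - 1) = a - b by field; rewrite gt_eqF.
lra.
Qed.

Lemma klxx a : kl a a = 0.
Proof.
rewrite /kl; have [->|a0] := eqVneq a 0.
  by rewrite mul0r !subr0 divff ?oner_neq0// ln1 mulr0 addr0.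
rewrite divff// ln1 mulr0 add0r.
have [->|a1] := eqVneq (1 - a) 0; first by rewrite mul0r.
by rewrite divff// ln1 mulr0.
Qed.

Lemma kl_ge0 a b : 0 < a < 1 -> 0 < b < 1 -> 0 <= kl a b.
Proof.
move=> a01 b01; have [->|ab] := eqVneq a b; first by rewrite klxx.
by rewrite ltW// kl_gt0.
Qed.

Lemma klC a b : kl (1 - a) (1 - b) = kl a b.
Proof.
have E (c : R) : 1 - (1 - c) = c by ring.
by rewrite /kl !E addrC.
Qed.

Lemma kl_split a b : 0 < a < 1 -> 0 < b < 1 ->
  kl a b = a * (ln a - ln b) + (1 - a) * (ln (1 - a) - ln (1 - b)).
Proof.
by move=> /andP[? ?] /andP[? ?]; rewrite /kl !ln_div ?posrE; lra.
Qed.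

Lemma kl_add a b : 0 < a < 1 -> 0 < b < 1 ->
  kl a b + kl b a = (b - a) * (ln (b / a) + ln ((1 - a) / (1 - b))).
Proof.
move=> a01 b01; rewrite !kl_split//; case/andP: a01 => ? ?; case/andP: b01 => ? ?.
by rewrite !ln_div ?posrE; lra.
Qed.

Lemma kl_nondecreasing_r a b c : 0 < a -> a <= b -> b <= c -> c < 1 ->
  kl a b <= kl a c.
Proof.
move=> a0 ab bc c1.
rewrite -subr_ge0 !kl_split; try by apply/andP; split; lra.
have b0 : 0 < b by lra.
have b1 : 0 < 1 - b by lra.
have := ln_leB1 (divr_gt0 (lt_le_trans b0 bc) b0).
have c1' : 0 < 1 - c by lra.
have := ln_leB1 (divr_gt0 c1' b1).
rewrite !ln_div ?posrE//; last by lra.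
have a1 : 0 < 1 - a by lra.
rewrite -(ler_pM2l a1) -[in X in _ -> X -> _](ler_pM2l a0).
have h : 0 <= (c - b) * (b - a) / (b * (1 - b)).
  by rewrite divr_ge0 ?mulr_ge0//; lra.
have : (c - b) * (b - a) / (b * (1 - b)) =
  - ((1 - a) * ((1 - c) / (1 - b) - 1)) - a * (c / b - 1).
  by field; rewrite !gt_eqF.
by lra.
Qed.

Lemma kl_nondecreasing_l a b c : 0 < a -> a <= b -> b <= c -> c < 1 ->
  kl b a <= kl c a.
Proof.
move=> a0 ab bc c1.
have := @kl_ge0 c b; have -> : 0 < c < 1 by apply/andP; split; lra.
have b01 : 0 < b < 1 by apply/andP; split; lra.
have a01 : 0 < a < 1 by apply/andP; split; lra.
rewrite b01 => /(_ isT isT).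
rewrite !kl_split//; try by apply/andP; split; lra.
have la : ln a <= ln b by rewrite ler_ln ?posrE; lra.
have la1 : ln (1 - b) <= ln (1 - a) by rewrite ler_ln ?posrE; lra.
by nra.
Qed.

End divergence_order.

(** * No minimum of the cost inside a segment *)

Section no_interior_minimum.
Context {R : realType}.
Implicit Types h : R.

(** The two slopes vanish at v2 and v1 in the notation of [kl_line_gap], and
    v1 < v2. *)
Lemma slopes_not_both_le0 (X Y : R) (L := X + Y) : 0 < L ->
  expR Y - expR (- X) <= L -> expR X - expR (- Y) <= L -> False.
Proof.
move=> L0 h1 h2; have := chord_gap_gt0 L0.
have Y0 := expR_gt0 Y; have X0 := expR_gt0 X.
have E1 : 1 < expR L by rewrite expR_gt1.
have LE : expR L = expR X * expR Y by rewrite expRD.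
have e1 : expR Y - expR (- X) = (expR L - 1) / expR X.
  by rewrite LE expRN; field; rewrite gt_eqF.
have e2 : expR X - expR (- Y) = (expR L - 1) / expR Y.
  by rewrite LE expRN; field; rewrite gt_eqF.
rewrite e1 in h1; rewrite e2 in h2.
rewrite ler_pdivrMr// in h1; rewrite ler_pdivrMr// in h2.
have u0 : 0 <= expR L - 1 by lra.
have := ler_pM u0 u0 h1 h2.
rewrite -expr2; have -> : L * expR X * (L * expR Y) = L ^+ 2 * expR L.
  by rewrite LE; ring.
by move=> /le_lt_trans /[apply]; rewrite ltxx.
Qed.

(** If w0 and w1 are proportional to c0 / (kl a b)^2 and c1 / (kl b a)^2, the
    hypothesis says that c0 / kl a b + c1 / kl b a is critical at (a, b) along
    the direction (1, t), and the last quantity is proportional to the opposite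
    of its second derivative. *)
Lemma critical_curvature (a b t w0 w1 : R)
    (f1 := kl_slope a b 1 t 0) (g1 := kl_slope b a t 1 0)
    (f2 := kl_curvature a b 1 t) (g2 := kl_curvature b a t 1) :
  0 < a -> a < b -> b < 1 -> 0 < t -> 0 < w0 -> 0 < w1 ->
  w0 * f1 + w1 * g1 = 0 ->
  f1 * g1 < 0 /\
  0 < w0 * f2 + w1 * g2 + 2 * (f1 * g1) * (w0 / kl b a + w1 / kl a b).
Proof.
move=> a0 ab b1 t0 w00 w10.
pose x := ln (b / a); pose y := ln ((1 - a) / (1 - b)).
pose X := x - ln t; pose Y := y + ln t.
pose d := expR Y - expR (- X) - (x + y).
pose r := expR X - expR (- Y) - (x + y).
have gap := kl_line_gap a0 ab b1 t0.
rewrite /= -/x -/y -/X -/Y -/d -/r in gap.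
have b0 : 0 < b by lra.
have a1 : 0 < 1 - a by lra.
have b1' : 0 < 1 - b by lra.
have LE : X + Y = x + y by rewrite /X /Y; lra.
have eX : expR X = b / a / t by rewrite /X expRB !lnK// ?posrE// ?divr_gt0.
have eY : expR Y = (1 - a) / (1 - b) * t.
  by rewrite /Y expRD !lnK// ?posrE// ?divr_gt0.
have L0 : 0 < X + Y.
  rewrite LE addr_gt0// ln_gt0// ltr_pdivlMr//; lra.
have f1E : f1 = d.
  rewrite /f1 /kl_slope !mulr0 !addr0 mul1r (ln_ratioN a0 b0) -/x -/y /d.
  by rewrite expRN eX eY; field; rewrite !gt_eqF.
have g1E : g1 = - (t * r).
  rewrite /g1 /kl_slope !mulr0 !addr0 mul1r (ln_ratioN b1' a1) -/x -/y /r.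
  by rewrite expRN eX eY; field; rewrite !gt_eqF.
have f2E : f2 = (1 - expR (- X)) ^+ 2 / a + (expR Y - 1) ^+ 2 / (1 - a).
  by rewrite /f2 /kl_curvature expRN eX eY; field; rewrite !gt_eqF.
have g2E : g2 =
    t ^+ 2 * ((expR X - 1) ^+ 2 / b + (1 - expR (- Y)) ^+ 2 / (1 - b)).
  by rewrite /g2 /kl_curvature expRN eX eY; field; rewrite !gt_eqF.
rewrite f1E g1E => crit; have kE : w0 * d = w1 * t * r by lra.
have wt0 : 0 < w1 * t by rewrite mulr_gt0.
have d0 : 0 < d.
  rewrite ltNge; apply/negP => dn.
  have rn : r <= 0 by rewrite -(pmulr_rle0 _ wt0) -kE pmulr_rle0.
  by apply: (slopes_not_both_le0 L0); rewrite LE -subr_le0.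
have r0 : 0 < r by rewrite -(pmulr_rgt0 _ wt0) -kE pmulr_rgt0.
split; first by rewrite mulrN oppr_lt0 !mulr_gt0.
have X0 : 0 < X by apply: (slope_gt0_arg L0); rewrite LE.
have Y0 : 0 < Y.
  by apply: (@slope_gt0_arg _ _ X); rewrite (addrC Y)// LE.
have hf : (expR Y + 1) * d / (1 - a) < f2.
  rewrite f2E; apply: (@lt_le_trans _ _ ((expR Y - 1) ^+ 2 / (1 - a))).
    rewrite ltr_pM2r ?invr_gt0//.
    by have := slope_lt_curvature X0 Y0; rewrite LE.
  by rewrite lerDr divr_ge0 ?sqr_ge0// ltW.
have hg : t ^+ 2 * ((expR X + 1) * r / b) < g2.
  rewrite g2E ltr_pM2l ?exprn_gt0//.
  apply: (@lt_le_trans _ _ ((expR X - 1) ^+ 2 / b)).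
    rewrite ltr_pM2r ?invr_gt0//.
    by have := slope_lt_curvature Y0 X0; rewrite (addrC Y) LE.
  by rewrite lerDl divr_ge0 ?sqr_ge0// ltW.
have k0 : 0 < w0 * d by rewrite mulr_gt0.
have {}gap := ler_wpM2l (ltW k0) (gap d0 r0).
rewrite -(ltr_pM2l w00) in hf; rewrite -(ltr_pM2l w10) in hg; move: hf hg.
have -> : w0 * ((expR Y + 1) * d / (1 - a)) =
  w0 * d * ((expR Y + 1) / (1 - a)) by ring.
have -> : w1 * (t ^+ 2 * ((expR X + 1) * r / b)) =
  w0 * d * (t * (expR X + 1) / b) by rewrite kE; ring.
have -> : 2 * (d * - (t * r)) * (w0 / kl b a + w1 / kl a b) =
    - (w0 * d * (2 * (d / kl a b + t * r / kl b a))).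
  have -> : w0 * d * (2 * (d / kl a b + t * r / kl b a)) =
    2 * (w0 * d * (d / kl a b)) + 2 * (w0 * d * (t * r / kl b a)) by ring.
  by rewrite {1}kE; ring.
move: gap; rewrite [leRHS]mulrDr.
set gD := w0 * d * (2 * _); set gf := _ * (_ / (1 - a)); set gg := _ * (_ / b).
by clear; lra.
Qed.

(** The cost of a design as a function of one of its quantizers, the others
    contributing d0 and d1 to the sums of divergences. *)
Definition cost (c0 c1 d0 d1 a b : R) : R :=
  c0 / (d0 + kl a b) + c1 / (d1 + kl b a).

(** Adding d0 and d1 to the denominators only helps: in the second derivative
    they lessen the part due to the squares of the first derivatives. *)
Lemma no_interior_minimum (a b t c0 c1 d0 d1 e : R) :
  0 < t -> 0 < c0 -> 0 < c1 -> 0 <= d0 -> 0 <= d1 -> 0 < e ->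
  (forall h, `|h| < e -> [/\ 0 < a + h, a + h < b + t * h & b + t * h < 1]) ->
  ~ (forall h, `|h| < e ->
      cost c0 c1 d0 d1 a b <= cost c0 c1 d0 d1 (a + h) (b + t * h)).
Proof.
move=> t0 c00 c10 d00 d10 e0 dom hmin.
have [a0 ab b1] : [/\ 0 < a, a < b & b < 1].
  by have := dom 0; rewrite normr0 mulr0 !addr0; exact.
pose A h := a + 1 * h; pose B h := b + t * h.
pose f h := kl (A h) (B h); pose g h := kl (B h) (A h).
have A00 : A 0 = a by rewrite /A mulr0 addr0.
have B00 : B 0 = b by rewrite /B mulr0 addr0.
have f0 : f 0 = kl a b by rewrite /f A00 B00.
have g0 : g 0 = kl b a by rewrite /g A00 B00.
have domA h : `|h| < e -> 0 < A h < 1.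
  by move=> /dom[]; rewrite /A mul1r => *; apply/andP; split; lra.
have domB h : `|h| < e -> 0 < B h < 1.
  by move=> /dom[]; rewrite /B => *; apply/andP; split; lra.
have domAB h : `|h| < e -> A h != B h.
  by move=> /dom[]; rewrite /A /B mul1r => *; rewrite lt_eqF.
have fgt0 h : `|h| < e -> 0 < f h.
  by move=> he; rewrite kl_gt0 ?domA ?domB ?domAB.
have ggt0 h : `|h| < e -> 0 < g h.
  by move=> he; rewrite kl_gt0 ?domA ?domB// eq_sym domAB.
pose f1 := kl_slope a b 1 t; pose g1 := kl_slope b a t 1.
pose f2 := kl_curvature a b 1 t; pose g2 := kl_curvature b a t 1.
have df h : `|h| < e -> is_derive h 1 f (f1 h).
  by move=> he; apply: is_derive_kl; [exact: domA|exact: domB].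
have dg h : `|h| < e -> is_derive h 1 g (g1 h).
  by move=> he; apply: is_derive_kl; [exact: domB|exact: domA].
have df1 : is_derive (0 : R) 1 f1 f2.
  by apply: is_derive_kl_slope; apply/andP; split; lra.
have dg1 : is_derive (0 : R) 1 g1 g2.
  by apply: is_derive_kl_slope; apply/andP; split; lra.
have e00 : `|0 : R| < e by rewrite normr0.
set D := kl a b in f0; set E := kl b a in g0.
have D0 : 0 < D by rewrite -f0 fgt0.
have E0 : 0 < E by rewrite -g0 ggt0.
pose x0 := d0 + D; pose y0 := d1 + E.
have x00 : 0 < x0 by rewrite /x0; lra.
have y00 : 0 < y0 by rewrite /y0; lra.
(* H h has the sign of the difference of the costs at h and at 0. *)
pose H h := c0 * y0 * (d1 + g h) * (D - f h) + c1 * x0 * (d0 + f h) * (E - g h).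
pose H1 h := c0 * y0 * (g1 h * (D - f h) - (d1 + g h) * f1 h) +
             c1 * x0 * (f1 h * (E - g h) - (d0 + f h) * g1 h).
pose H2 := c0 * y0 * (- 2 * f1 0 * g1 0 - y0 * f2) +
           c1 * x0 * (- 2 * f1 0 * g1 0 - x0 * g2).
have dH h : `|h| < e -> is_derive h 1 H (H1 h).
  move=> he; have dfh := df h he; have dgh := dg h he.
  by apply: is_derive_eq; rewrite /H1 /GRing.scale/=; ring.
have dH1 : is_derive (0 : R) 1 H1 H2.
  have dfh := df 0 e00; have dgh := dg 0 e00.
  by apply: is_derive_eq; rewrite /H2 /x0 /y0 f0 g0 /GRing.scale/=; ring.
have H00 : H 0 = 0 by rewrite /H f0 g0 !subrr !mulr0 addr0.
have Hmin h : `|h| < e -> H 0 <= H h.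
  move=> he; rewrite H00; have := hmin h he.
  rewrite /cost -/D -/E -/x0 -/y0.
  have -> : kl (a + h) (b + t * h) = f h by rewrite /f /A mul1r.
  have -> : kl (b + t * h) (a + h) = g h by rewrite /g /A mul1r.
  have := fgt0 h he; have := ggt0 h he; rewrite /H.
  set p := f h; set q := g h => q0 p0.
  have xp : 0 < d0 + p by lra.
  have yq : 0 < d1 + q by lra.
  rewrite -subr_ge0.
  have -> : c0 / (d0 + p) + c1 / (d1 + q) - (c0 / x0 + c1 / y0) =
     (c0 * y0 * (d1 + q) * (D - p) + c1 * x0 * (d0 + p) * (E - q)) /
     (x0 * y0 * (d0 + p) * (d1 + q)).
    by rewrite /x0 /y0; field; rewrite !gt_eqF.
  by rewrite pmulr_lge0 // invr_gt0 !mulr_gt0.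
have [] := second_derivative_test e0 dH dH1 Hmin.
rewrite /H1 f0 g0 !subrr !mulr0 !sub0r -/x0 -/y0 /H2 => H10 H20.
have w00 : 0 < c0 * y0 ^+ 2 by rewrite mulr_gt0 ?exprn_gt0.
have w10 : 0 < c1 * x0 ^+ 2 by rewrite mulr_gt0 ?exprn_gt0.
have crit : c0 * y0 ^+ 2 * f1 0 + c1 * x0 ^+ 2 * g1 0 = 0.
  by apply: oppr_inj; rewrite oppr0 -[RHS]H10; ring.
have [fg] := critical_curvature a0 ab b1 t0 w00 w10 crit.
rewrite -/f1 -/g1 -/f2 -/g2 -/D -/E in fg *; apply/negP; rewrite -leNgt.
apply: (@le_trans _ _ (c0 * y0 ^+ 2 * f2 + c1 * x0 ^+ 2 * g2 +
    2 * (f1 0 * g1 0) * (c0 * y0 ^+ 2 / y0 + c1 * x0 ^+ 2 / x0))).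
  rewrite lerD2l ler_wnM2l//; first by rewrite pmulr_rle0// ltW.
  by apply: lerD; rewrite ler_pM2l// lef_pV2 ?posrE// /x0 /y0 lerDr.
rewrite -oppr_ge0; apply: le_trans H20 _; rewrite le_eqVlt; apply/orP; left.
by apply/eqP; field; rewrite !gt_eqF.
Qed.

End no_interior_minimum.

(** * Thresholding the likelihood ratio *)

Section distribution_functions.
Context d (T : measurableType d) (R : realType) (P : probability T R).

Lemma cdf_right_ge (r : {RV P >-> R}) (t c : R) :
  (forall s : R, t < s -> (c%:E <= P (r @^-1` `]-oo, s]))%E) ->
  (c%:E <= P (r @^-1` `]-oo, t]))%E.
Proof.
move=> h; have := @cdf_right_continuous _ _ _ _ r t.
apply: cvge_ge; near=> s; apply: h; near: s.
exact: nbhs_right_gt.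
Unshelve. all: by end_near. Qed.

Lemma tail_small (r : {RV P >-> R}) (c : R) : 0 < c ->
  exists2 t, 0 < t & (P (r @^-1` `]t, +oo[) <= c%:E)%E.
Proof.
move=> c0; have := @cvg_ccdfy0 _ _ _ _ r.
have c0' : (0 < c%:E)%E by rewrite lte_fin.
move=> /(_ _ (open_ereal_lt' c0')) [M [_ hM]].
exists (Num.max 1 (M + 1)); first by rewrite lt_max ltr01.
apply/ltW/hM; rewrite lt_max; apply/orP; right; lra.
Qed.

End distribution_functions.

Section neyman_pearson.
Context {d : measure_display} {X : measurableType d} {R : realType}.
Context (mu : {measure set X -> \bar R}) (P0 P1 : probability X R).
Context (f0 f1 : X -> R).
Hypotheses (hP01 : P0 `<< P1) (hP10 : P1 `<< P0).
Hypotheses (hf0 : is_density P0 mu f0) (hf1 : is_density P1 mu f1).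

Definition pr (P : probability X R) (A : set X) : R := fine (P A).

Lemma prE (P : probability X R) A : measurable A -> P A = (pr P A)%:E.
Proof. by move=> mA; rewrite /pr fineK// fin_num_measure. Qed.

Lemma pr_ge0 (P : probability X R) A : 0 <= pr P A.
Proof. exact: fine_ge0. Qed.

Lemma pr_le1 (P : probability X R) A : measurable A -> pr P A <= 1.
Proof. by move=> mA; rewrite -lee_fin -prE// probability_le1. Qed.

Lemma prDI (P : probability X R) A B : measurable A -> measurable B ->
  pr P A = pr P (A `\` B) + pr P (A `&` B).
Proof.
move=> mA mB; apply: EFin_inj; rewrite EFinD -!prE//.
- exact: measureDI.
- exact: measurableI.
- exact: measurableD.
Qed.

Lemma pr_le (P : probability X R) A B : measurable A -> measurable B ->
  A `<=` B -> pr P A <= pr P B.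
Proof.
by move=> mA mB AB; rewrite -lee_fin -!prE// le_measure// inE.
Qed.

Lemma pr_setC (P : probability X R) A : measurable A ->
  pr P (~` A) = 1 - pr P A.
Proof.
move=> mA; apply: EFin_inj; rewrite EFinB -!prE ?probability_setC//.
exact: measurableC.
Qed.

Let mf0 : measurable_fun setT f0. Proof. by case: hf0. Qed.
Let mf1 : measurable_fun setT f1. Proof. by case: hf1. Qed.
Let f0_ge0 x : 0 <= f0 x. Proof. by case: hf0. Qed.
Let f1_ge0 x : 0 <= f1 x. Proof. by case: hf1. Qed.

(** Equal to 0, rather than infinite, where f0 vanishes: a null set. *)
Definition lr (x : X) : R := f1 x / f0 x.

Lemma measurable_lr : measurable_fun setT lr.
Proof.
rewrite (_ : lr = fun x => f1 x * (f0 x `^ (-1))); last first.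
  by apply/funext => x; rewrite powR_inv1.
apply: measurable_funM => //.
exact: (measurableT_comp (measurable_powR (-1)) mf0).
Qed.

Lemma measurable_lr_preimage (i : interval R) : measurable (lr @^-1` [set` i]).
Proof.
by have := measurable_lr measurableT (measurable_itv i); rewrite setTI.
Qed.

(** Where f0 vanishes lr is 0 whatever f1 is, so that this part of A has to be
    discarded first: it is P0-null, hence P1-null. *)
Lemma pr_le_lr A t : measurable A -> 0 <= t -> (forall x, A x -> lr x <= t) ->
  pr P1 A <= t * pr P0 A.
Proof.
move=> mA t0 At; pose N := f0 @^-1` [set 0].
have mN : measurable N by rewrite -[N]setTI; exact: mf0.
have [_ _ P0E] := hf0; have [_ _ P1E] := hf1.
have P0N : P0 N = 0%E.
  rewrite P0E//; apply: integral0_eq => x /= ->//.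
have P1N : P1 N = 0%E by move/null_content_dominatesP: hP10 => /(_ _ mN P0N).
have mAN : measurable (A `\` N) by exact: measurableD.
have -> : pr P1 A = pr P1 (A `\` N).
  rewrite (prDI _ mA mN) /pr (_ : P1 (A `&` N) = 0%E) ?addr0//.
  apply/eqP; rewrite eq_le measure_ge0 andbT -P1N le_measure ?inE//.
  exact: measurableI.
apply: (@le_trans _ _ (t * pr P0 (A `\` N))); last first.
  by rewrite ler_wpM2l// pr_le// => x [].
rewrite -lee_fin EFinM -!prE// P0E// P1E// -ge0_integralZl_EFin//; first last.
- by apply/measurable_EFinP; exact: measurable_funS mf0.
- by move=> x _; rewrite lee_fin.
apply: ge0_le_integral => //.
- by move=> x _; rewrite lee_fin.
- by apply/measurable_EFinP; exact: measurable_funS mf1.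
- apply/measurable_EFinP; apply: measurable_funM => //.
  exact: measurable_funS mf0.
- move=> x [Ax Nx]; rewrite -EFinM lee_fin.
  have f0x : 0 < f0 x by rewrite lt_neqAle f0_ge0 andbT; apply/eqP => /esym.
  by have := At x Ax; rewrite /lr ler_pdivrMr.
Qed.

Lemma pr_ge_lr A t : measurable A -> 0 <= t -> (forall x, A x -> t <= lr x) ->
  t * pr P0 A <= pr P1 A.
Proof.
move=> mA t0 At.
have [_ _ P0E] := hf0; have [_ _ P1E] := hf1.
rewrite -lee_fin EFinM -!prE// P0E// P1E// -ge0_integralZl_EFin//; first last.
- by apply/measurable_EFinP; exact: measurable_funS mf0.
- by move=> x _; rewrite lee_fin.
apply: ge0_le_integral => //.
- by move=> x _; rewrite -EFinM lee_fin mulr_ge0.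
- apply/measurable_EFinP; apply: measurable_funM => //.
  exact: measurable_funS mf0.
- by apply/measurable_EFinP; exact: measurable_funS mf1.
- move=> x Ax; rewrite -EFinM lee_fin.
  have [f0x|f0x] := eqVneq (f0 x) 0; first by rewrite f0x mulr0.
  have {}f0x : 0 < f0 x by rewrite lt_neqAle f0_ge0 andbT eq_sym.
  by have := At x Ax; rewrite /lr ler_pdivlMr.
Qed.

(** The set U is a likelihood ratio test of threshold t with an arbitrary
    decision on the threshold itself. *)
Lemma neyman_pearson A U t : measurable A -> measurable U -> 0 <= t ->
  (forall x, t < lr x -> U x) -> (forall x, U x -> t <= lr x) ->
  pr P1 A - t * pr P0 A <= pr P1 U - t * pr P0 U.
Proof.
move=> mA mU t0 tU Ut.
rewrite (prDI P0 mA mU) (prDI P1 mA mU) (prDI P0 mU mA) (prDI P1 mU mA).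
rewrite (setIC U A).
have h1 : pr P1 (A `\` U) <= t * pr P0 (A `\` U).
  apply: pr_le_lr => //; first exact: measurableD.
  by move=> x [_ Ux]; rewrite leNgt; apply/negP => /tU.
have h2 : t * pr P0 (U `\` A) <= pr P1 (U `\` A).
  apply: pr_ge_lr => //; first exact: measurableD.
  by move=> x [/Ut].
by rewrite !mulrDr; lra.
Qed.

End neyman_pearson.

(** * The boundary of the achievable error probabilities *)

Section roc.
Context {d : measure_display} {X : measurableType d} {R : realType}.
Context (mu : {measure set X -> \bar R}) (P0 P1 : probability X R).
Context (f0 f1 : X -> R).
Hypotheses (hP01 : P0 `<< P1) (hP10 : P1 `<< P0).
Hypotheses (hf0 : is_density P0 mu f0) (hf1 : is_density P1 mu f1).

Let rho := lr f0 f1.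
Definition above t : set X := lr f0 f1 @^-1` `]t, +oo[.
Definition at_least t : set X := lr f0 f1 @^-1` `[t, +oo[.
Let p0 := pr P0.
Let p1 := pr P1.

Let mrho (i : interval R) : measurable (rho @^-1` [set` i]).
Proof. exact: measurable_lr_preimage hf0 hf1 i. Qed.

Let mab t : measurable (above t). Proof. exact: mrho. Qed.
Let mal t : measurable (at_least t). Proof. exact: mrho. Qed.

Let rhoX : {mfun X >-> R} :=
  HB.pack rho (isMeasurableFun.Build _ _ _ _ rho (measurable_lr hf0 hf1)).

(** The largest value of P1 A - t P0 A, by [neyman_pearson]. *)
Definition excess t : R := pr P1 (above t) - t * pr P0 (above t).

Lemma le_excess A t : measurable A -> 0 <= t ->
  p1 A <= excess t + t * p0 A.
Proof.
move=> mA t0.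
have := @neyman_pearson _ _ _ _ _ _ _ _ hP10 hf0 hf1 A (above t) t mA (mab t) t0.
have h1 x : t < rho x -> above t x by move=> h; rewrite /above/= in_itv/= h.
have h2 x : above t x -> t <= rho x.
  by rewrite /above/= in_itv/= andbT => /ltW.
by move=> /(_ h1 h2); rewrite -/p0 -/p1 /excess -/p0 -/p1; lra.
Qed.

Lemma excess_at_least t : 0 <= t -> excess t = p1 (at_least t) - t * p0 (at_least t).
Proof.
move=> t0; apply/le_anti/andP; split; last first.
  by have := le_excess (mal t) t0; lra.
apply: (@neyman_pearson _ _ _ _ _ _ _ _ hP10 hf0 hf1 (above t)) => // x.
  by rewrite /at_least/= in_itv/= andbT => /ltW.
by rewrite /at_least/= in_itv/= andbT.
Qed.

Lemma excess_ge0 t : 0 <= t -> 0 <= excess t.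
Proof.
move=> t0; have := le_excess measurable0 t0.
by rewrite /p0 /p1 /pr !measure0/=; lra.
Qed.

(** The upper boundary of the convex hull of the pairs (P0 A, P1 A), as the
    infimum of its supporting lines, whose slopes are the thresholds: this is
    the receiver operating characteristic of the optimal tests. *)
Definition roc a : R := inf [set excess t + t * a | t in [set t | 0 <= t]].

Lemma roc_le a t : 0 <= a -> 0 <= t -> roc a <= excess t + t * a.
Proof.
move=> a0 t0; apply: ge_inf; last by exists t.
exists 0 => _ [s s0 <-]; rewrite addr_ge0 ?mulr_ge0//.
exact: excess_ge0.
Qed.

Lemma le_roc a b : (forall t, 0 <= t -> b <= excess t + t * a) -> b <= roc a.
Proof.
move=> h; apply: lb_le_inf; first by exists (excess 0 + 0 * a), 0 => /=.
by move=> _ [s s0 <-]; exact: h.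
Qed.

(** Each threshold t whose level set has positive probability gives a segment
    of slope t on the boundary, whose ends are the two deterministic ways to
    decide on that level set. *)
Lemma roc_segment t a : 0 <= t -> p0 (above t) <= a <= p0 (at_least t) ->
  roc a = excess t + t * a.
Proof.
move=> t0 /andP[ha hb].
have a0 : 0 <= a by apply: le_trans ha; exact: pr_ge0.
apply/le_anti; rewrite roc_le//=; apply: le_roc => s s0.
have [st|st] := leP s t.
  have := le_excess (mal t) s0; rewrite (excess_at_least t0).
  have : (t - s) * a <= (t - s) * p0 (at_least t) by rewrite ler_wpM2l//; lra.
  by lra.
have := le_excess (mab t) s0; rewrite {2}/excess -/p0 -/p1.
have : (s - t) * p0 (above t) <= (s - t) * a by rewrite ler_wpM2l//; lra.
by lra.
Qed.

(** The likelihood ratio has no atom at 0: as lr = 0 is P1-null, it is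
    P0-null. *)
Lemma pr0_small (e : R) : 0 < e -> exists2 t, 0 < t & 1 - p0 (above t) < e.
Proof.
move=> e0; apply: contrapT => h.
have mle : measurable (rho @^-1` `]-oo, 0]) by exact: mrho.
have P1z : P1 (rho @^-1` `]-oo, 0]) = 0%E.
  have := @pr_le_lr _ _ _ _ _ _ _ _ hP10 hf0 hf1 _ 0 mle (lexx 0).
  move=> /(_ _)/[!mul0r] H; rewrite prE//; congr EFin; apply/le_anti.
  rewrite pr_ge0 andbT; apply: H => x; rewrite /= in_itv/=; exact.
have P0z : P0 (rho @^-1` `]-oo, 0]) = 0%E.
  by move/null_content_dominatesP: hP01 => /(_ _ mle P1z).
have : (e%:E <= P0 (rhoX @^-1` `]-oo, (0 : R)%R]))%E.
  apply: cdf_right_ge => s s0.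
  rewrite leNgt; apply/negP => hs; apply: h; exists s => //.
  have -> : above s = ~` (rho @^-1` `]-oo, s]).
    by rewrite /above preimage_setC setCitvl.
  by move: hs; rewrite /p0 pr_setC// prE// lte_fin; lra.
by rewrite P0z lee_fin leNgt e0.
Qed.

(** The threshold is the (1 - a)-quantile of the likelihood ratio under P0. *)
Lemma threshold_exists (a : R) : 0 < a < 1 ->
  exists2 t, 0 < t & p0 (above t) <= a <= p0 (at_least t).
Proof.
move=> /andP[a0 a1]; have a1' : 0 < 1 - a by lra.
have [t1 t10 ht1] := pr0_small a1'.
have {}ht1 : a < p0 (above t1) by have := ht1; lra.
pose S := [set t | p0 (above t) <= a].
have [t2 t20 ht2] := @tail_small _ _ _ P0 rhoX a a0.
have S2 : S t2 by rewrite /S/= -lee_fin -prE.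
have p0mono s t : s <= t -> p0 (above t) <= p0 (above s).
  move=> st; apply: pr_le => // x; rewrite /above/= !in_itv/= !andbT.
  exact: le_lt_trans.
have lbS : lbound S t1.
  move=> s Ss; rewrite leNgt; apply/negP => st.
  by have := p0mono _ _ (ltW st); have : p0 (above s) <= a by []; lra.
have hlb : has_lbound S by exists t1.
pose t := inf S.
have t1t : t1 <= t by apply: lb_le_inf => //; exists t2.
exists t; first by lra.
apply/andP; split.
  have : ((1 - a)%:E <= P0 (rhoX @^-1` `]-oo, t]))%E.
    apply: cdf_right_ge => s ts.
    have [s' Ss' s's] : exists2 s', S s' & s' < s.
      by apply: inf_lt => //; exists t2.
    have := p0mono _ _ (ltW s's); have : p0 (above s') <= a by [].
    have -> : rhoX @^-1` `]-oo, s] = ~` above s.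
      by rewrite /above preimage_setC setCitvr.
    by rewrite prE ?pr_setC//; [rewrite lee_fin -/p0; lra|exact: measurableC].
  have -> : rhoX @^-1` `]-oo, t] = ~` above t.
    by rewrite /above preimage_setC setCitvr.
  by rewrite prE ?pr_setC//; [rewrite lee_fin -/p0; lra|exact: measurableC].
(* The left limit at t is the right limit at - t for the opposite variable. *)
pose rhoN : {mfun X >-> R} := HB.pack (fun x => - rho x)
  (isMeasurableFun.Build _ _ _ _ (fun x => - rho x)
    (measurable_funN (measurable_lr hf0 hf1))).
have : (a%:E <= P0 (rhoN @^-1` `]-oo, (- t)%R]))%E.
  apply: cdf_right_ge => s ts.
  apply: (@le_trans _ _ (P0 (above (- s)))).
    rewrite prE// lee_fin -/p0 leNgt; apply/negP => /ltW Ss.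
    have : t <= - s by apply: ge_inf.
    by lra.
  rewrite le_measure ?inE//.
    rewrite (_ : _ @^-1` _ = at_least (- s)) //.
    by apply/seteqP; split => x /=; rewrite /at_least/= !in_itv/= andbT lerNl.
  by move=> x; rewrite /above/= !in_itv/= andbT => h; rewrite lerNl ltW.
rewrite (_ : _ @^-1` _ = at_least t) ?prE ?lee_fin//.
by apply/seteqP; split => x /=; rewrite /at_least/= !in_itv/= andbT lerN2.
Qed.

Lemma roc_ge a : 0 <= a <= 1 -> a <= roc a.
Proof.
move=> /andP[a0 a1]; apply: le_roc => t t0.
have := excess_ge0 t0.
have := le_excess measurableT t0.
rewrite /p0 /p1 /pr !probability_setT/= => h1 h2.
have [t1|t1] := leP 1 t; first by nra.
by nra.
Qed.

Lemma roc_le1 a : 0 <= a -> roc a <= 1.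
Proof.
move=> a0; apply: le_trans (roc_le a0 (lexx 0)) _.
by rewrite mul0r addr0 /excess mul0r subr0 pr_le1.
Qed.

Lemma roc_lt1 a : 0 <= a -> a < 1 -> roc a < 1.
Proof.
move=> a0 a1; have a1' : 0 < 1 - a by lra.
have [t t0 ht] := pr0_small a1'.
apply: le_lt_trans (roc_le a0 (ltW t0)) _.
have : p1 (above t) <= 1 by exact: pr_le1.
rewrite /excess -/p0 -/p1.
have : t * (1 - p0 (above t)) < t * (1 - a) by rewrite ltr_pM2l.
by lra.
Qed.

Lemma roc_nondecreasing a b : 0 <= a -> a <= b -> roc a <= roc b.
Proof.
move=> a0 ab; apply: le_roc => t t0; apply: le_trans (roc_le a0 t0) _.
by rewrite lerD2l ler_wpM2l.
Qed.

(** The slope t at a satisfies t a <= excess t + t a = roc a <= 1. *)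
Lemma roc_lipschitz a b : 0 < a < 1 -> a <= b -> roc b <= roc a + (b - a) / a.
Proof.
move=> /andP[a0 a1] ab.
have [|t t0 ht] := @threshold_exists a; first by rewrite a0.
have E := roc_segment (ltW t0) ht.
have b0 : 0 <= b by lra.
apply: le_trans (roc_le b0 (ltW t0)) _.
have h1 : t * a <= 1.
  by have := roc_le1 (ltW a0); rewrite E; have := excess_ge0 (ltW t0); lra.
have h2 : (b - a) * t <= (b - a) / a.
  by rewrite ler_wpM2l ?subr_ge0// -[a^-1]mul1r ler_pdivlMr.
by rewrite E; lra.
Qed.

(** The likelihood ratio is finite, so that the boundary starts at 0 without a
    jump. *)
Lemma roc_small (e : R) : 0 < e -> exists2 a, 0 < a & forall s, 0 <= s < a -> roc s <= e.
Proof.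
move=> e0; have e20 : 0 < e / 2 by lra.
have [t t0 ht] := @tail_small _ _ _ P1 rhoX _ e20.
exists (e / 2 / t); first by rewrite divr_gt0.
move=> s /andP[s0 st]; apply: le_trans (roc_le s0 (ltW t0)) _.
have h1 : p1 (above t) <= e / 2 by rewrite -lee_fin -prE.
have h2 : t * s <= e / 2 by move: st; rewrite ltr_pdivlMr// mulrC => /ltW.
have h3 : 0 <= t * p0 (above t) by rewrite mulr_ge0 ?pr_ge0// ltW.
by rewrite /excess -/p0 -/p1; lra.
Qed.

End roc.

(** * Output laws of binary quantizers *)

Section output_laws.
Context {d : measure_display} {X : measurableType d} {R : realType}.
Context (P0 P1 : probability X R).
Implicit Types (P : probability X R) (q : rand_quantizer P0 P1 1).

(** The letter whose probabilities are the coordinates of a quantizer. *)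
Definition letter1 : 'I_2 := ord_max.

Let is_law P := P = P0 \/ P = P1.

Lemma measurable_det_law P u : is_law P ->
  measurable_fun setT (fun phi : det_quantizer P0 P1 1 => det_law P phi u).
Proof.
move=> hP _ B mB; rewrite setTI; apply: sub_sigma_algebra.
by exists P, u, B.
Qed.

Lemma measurable_quantizer_preimage (phi : {mfun X >-> 'I_2}) u :
  measurable (phi @^-1` [set u]).
Proof. by rewrite -[X in measurable X]setTI; exact: measurable_funP. Qed.

Lemma det_lawE P (phi : {mfun X >-> 'I_2}) u :
  det_law P phi u = (pr P (phi @^-1` [set u]))%:E.
Proof. by rewrite /det_law prE//; exact: measurable_quantizer_preimage. Qed.

Lemma det_law_le1 P (phi : {mfun X >-> 'I_2}) u : (det_law P phi u <= 1)%E.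
Proof. exact/probability_le1/measurable_quantizer_preimage. Qed.

Lemma integral_total_mass q (c : R) : (\int[q]_phi cst c%:E phi = c%:E)%E.
Proof.
rewrite integral_cst//; transitivity (c%:E * 1)%E; last exact: mule1.
by congr (_ * _)%E; exact: probability_setT.
Qed.

Lemma integral_det_law_fin P q u : is_law P ->
  (\int[q]_phi det_law P (phi : {mfun X >-> 'I_2}) u = (law P q u)%:E)%E.
Proof.
move=> hP; rewrite /law fineK// ge0_fin_numE; last exact: integral_ge0.
apply: (@le_lt_trans _ _ (\int[q]_phi cst 1%E phi)%E).
  apply: ge0_le_integral => //; first exact: measurable_det_law.
  by move=> phi _; exact: det_law_le1.
by rewrite integral_total_mass ltry.
Qed.

Lemma law_ge0 P q u : 0 <= law P q u.
Proof. by apply: fine_ge0; exact: integral_ge0. Qed.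

Lemma law_zero P q : is_law P -> law P q ord0 = 1 - law P q letter1.
Proof.
move=> hP; apply/eqP; rewrite eq_sym subr_eq; apply/eqP/EFin_inj.
rewrite EFinD -!integral_det_law_fin// -ge0_integralD//; first last.
- exact: measurable_det_law.
- exact: measurable_det_law.
rewrite (_ : (fun _ => _) = cst 1%E).
  exact: (esym (integral_total_mass q 1)).
apply/funext => phi /=; rewrite /det_law -measureU.
- rewrite (_ : _ `|` _ = setT); first exact: probability_setT.
  apply/seteqP; split => // x _ /=.
  case: (phi x) => -[|[|//]] i; [left|right]; exact: val_inj.
- exact: measurable_quantizer_preimage.
- exact: measurable_quantizer_preimage.
- by apply/seteqP; split => // x [/= ->].
Qed.

Lemma law_le1 P q : is_law P -> law P q letter1 <= 1.
Proof. by move=> hP; have := law_ge0 P q ord0; rewrite law_zero//; lra. Qed.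

Lemma D0E q : D0 q = kl (law P0 q letter1) (law P1 q letter1).
Proof.
rewrite /D0 /divergence !big_ord_recl big_ord0 addr0.
rewrite (_ : lift ord0 ord0 = letter1); last exact: val_inj.
by rewrite !law_zero; [rewrite /kl addrC|right|left].
Qed.

Lemma D1E q : D1 q = kl (law P1 q letter1) (law P0 q letter1).
Proof.
rewrite /D1 /divergence !big_ord_recl big_ord0 addr0.
rewrite (_ : lift ord0 ord0 = letter1); last exact: val_inj.
by rewrite !law_zero; [rewrite /kl addrC|left|right].
Qed.

Lemma law_deterministic P (phi : {mfun X >-> 'I_2}) u : is_law P ->
  law P (deterministic P0 P1 phi) u = pr P (phi @^-1` [set u]).
Proof.
move=> hP; rewrite /law /deterministic integral_dirac//; last first.
  exact: measurable_det_law.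
by rewrite diracE mem_set// mul1e det_lawE.
Qed.

(** The mixture is the image under the choice between phi and psi of the toss
    of a coin of bias g. *)
Lemma mixture_law (g : R) (phi psi : {mfun X >-> 'I_2}) : 0 <= g <= 1 ->
  exists q, forall P, is_law P ->
    law P q letter1 = g * pr P (phi @^-1` [set letter1]) +
                  (1 - g) * pr P (psi @^-1` [set letter1]).
Proof.
move=> g01.
pose F (b : bool) : det_quantizer P0 P1 1 := if b then phi else psi.
have mF : measurable_fun setT F by [].
pose FX : {mfun bool >-> det_quantizer P0 P1 1} :=
  HB.pack F (isMeasurableFun.Build _ _ _ _ F mF).
exists (distribution (bernoulli_prob g) FX) => P hP.
rewrite /law ge0_integral_distribution//; last exact: measurable_det_law.
rewrite integral_bernoulli_prob//=.
have E := det_lawE P; rewrite /F /= (E phi) (E psi).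
by rewrite -!EFinM -EFinD.
Qed.

Lemma llr_varianceE P q : is_law P ->
  let p := law P q letter1 in
  llr_variance P q = p * (1 - p) * (llr q letter1 - llr q ord0) ^+ 2.
Proof.
move=> hP p; rewrite /llr_variance /variance_of /expectation_of.
rewrite !big_ord_recl !big_ord0 !addr0.
rewrite (_ : lift ord0 ord0 = letter1); last exact: val_inj.
by rewrite law_zero// -/p; ring.
Qed.

End output_laws.

Section achievable_laws.
Context {d : measure_display} {X : measurableType d} {R : realType}.
Context (mu : {measure set X -> \bar R}) (P0 P1 : probability X R).
Context (f0 f1 : X -> R).
Hypotheses (hP01 : P0 `<< P1) (hP10 : P1 `<< P0).
Hypotheses (hf0 : is_density P0 mu f0) (hf1 : is_density P1 mu f1).
Implicit Types (q : rand_quantizer P0 P1 1).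

(** The bound for deterministic quantizers is affine in the law, so that it
    survives randomization. *)
Lemma law_le_excess q u t : 0 <= t ->
  law P1 q u <= excess P0 P1 f0 f1 t + t * law P0 q u.
Proof.
move=> t0.
have e0 : 0 <= excess P0 P1 f0 f1 t by exact: excess_ge0 hP10 hf0 hf1 _ t0.
have hy0 : P0 = P0 \/ P0 = P1 by left.
have hy1 : P1 = P0 \/ P1 = P1 by right.
rewrite -lee_fin EFinD EFinM -!integral_det_law_fin//.
rewrite -ge0_integralZl_EFin//; last exact: measurable_det_law.
rewrite -(integral_total_mass q).
rewrite -ge0_integralD//; first last.
- by apply: measurable_funeM; exact: measurable_det_law.
- by move=> phi _; rewrite mule_ge0// lee_fin.
apply: ge0_le_integral => //.
- exact: measurable_det_law.
- by apply: emeasurable_funD => //; apply: measurable_funeM; exact: measurable_det_law.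
- move=> phi _ /=; rewrite !det_lawE -EFinM -EFinD lee_fin.
  by apply: le_excess hP10 hf0 hf1 _ _ _ t0; exact: measurable_quantizer_preimage.
Qed.

Lemma law_le_roc q u : law P1 q u <= roc P0 P1 f0 f1 (law P0 q u).
Proof. by apply: le_roc => t t0; exact: law_le_excess. Qed.

End achievable_laws.

Section threshold_quantizers.
Context {d : measure_display} {X : measurableType d} {R : realType}.
Context (mu : {measure set X -> \bar R}) (P0 P1 : probability X R).
Context (f0 f1 : X -> R).
Hypotheses (hf0 : is_density P0 mu f0) (hf1 : is_density P1 mu f1).

(** The boolean tells how the tie lr = t is broken. *)
Definition threshold_fun (b : bool) (t : R) (x : X) : 'I_2 :=
  if (if b then t <= lr f0 f1 x else t < lr f0 f1 x) then letter1 else ord0.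

Lemma measurable_threshold_fun b t : measurable_fun setT (threshold_fun b t).
Proof.
have ml := measurable_lr hf0 hf1.
by apply: measurable_fun_ifT => //; case: b;
  [exact: measurable_fun_ler|exact: measurable_fun_ltr].
Qed.

Definition threshold_quantizer b t : {mfun X >-> 'I_2} :=
  HB.pack (threshold_fun b t)
    (isMeasurableFun.Build _ _ _ _ _ (measurable_threshold_fun b t)).

Lemma threshold_quantizer_preimage b t :
  threshold_quantizer b t @^-1` [set letter1] =
  if b then at_least f0 f1 t else above f0 f1 t.
Proof.
have z : ord0 = letter1 -> False by move=> /(congr1 val).
case: b; apply/seteqP; split => x; rewrite /= /threshold_fun;
  rewrite /at_least /above/= in_itv/= andbT; case: ifP => //; by [].
Qed.

Lemma threshold_quantizerP b t :
  likelihood_ratio_threshold_rule P0 f0 f1 (threshold_quantizer b t).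
Proof.
exists (fun l => if l is l'.+1 then if l' is _.+1 then +oo%E else t%:E else -oo%E).
exists 1%g; split => //.
- by move=> [|[|//]] _; rewrite ?ltNyr ?ltry.
- move=> [[|[|//]] i]; apply: aeW => x /=; rewrite perm1 /threshold_fun -/(lr f0 f1 x).
    rewrite lte_fin => /andP[_ lt]; case: b; rewrite ?leNgt ?lt//=; last first.
      by rewrite ltNge (ltW lt)/=; exact: val_inj.
    exact: val_inj.
  rewrite lte_fin => /andP[lt _]; case: b; rewrite ?(ltW lt) ?lt; exact: val_inj.
- move=> [[|[|//]] i] [[|[|//]] j] //= _.
  case: b; [right|left]; apply: aeW => x /=; rewrite perm1 /threshold_fun -/(lr f0 f1 x);
    move=> -[->]; rewrite ?lexx ?ltxx; exact: val_inj.
Qed.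

End threshold_quantizers.

(** * Divergences along the boundary *)

Section divergence_continuity.
Context {R : realType}.

Lemma kl_cvg (T : Type) (F : set_system T) (FF : Filter F) (f g : T -> R) (a b : R) :
  0 < a < 1 -> 0 < b < 1 -> f @ F --> a -> g @ F --> b ->
  (fun x => kl (f x) (g x)) @ F --> kl a b.
Proof.
move=> /andP[a0 a1] /andP[b0 b1] fa gb.
have a1' : 0 < 1 - a by lra.
have b1' : 0 < 1 - b by lra.
have f1 : (fun x => 1 - f x) @ F --> 1 - a by apply: cvgB => //; exact: cvg_cst.
have g1 : (fun x => 1 - g x) @ F --> 1 - b by apply: cvgB => //; exact: cvg_cst.
have cln (u v : T -> R) (p q : R) : 0 < p -> 0 < q -> u @ F --> p -> v @ F --> q ->
    (fun x => ln (u x / v x)) @ F --> ln (p / q).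
  move=> p0 q0 up vq; apply: continuous_cvg.
    by apply: continuous_ln; rewrite divr_gt0.
  by apply: cvgM => //; apply: cvgV => //; rewrite gt_eqF.
apply: cvgD; apply: cvgM => //.
  exact: (cln f g).
exact: (cln (fun x => 1 - f x) (fun x => 1 - g x)).
Qed.

End divergence_continuity.

Section gains.
Context {d : measure_display} {X : measurableType d} {R : realType}.
Context (mu : {measure set X -> \bar R}) (P0 P1 : probability X R).
Context (f0 f1 : X -> R).
Hypotheses (hP01 : P0 `<< P1) (hP10 : P1 `<< P0).
Hypotheses (hf0 : is_density P0 mu f0) (hf1 : is_density P1 mu f1).
Hypothesis hne : positive_divergences P0 P1 1 !=set0.
Hypothesis hvar : bounded_llr_variance (positive_divergences P0 P1 1).
Implicit Types (s e : R) (q : rand_quantizer P0 P1 1).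

Let beta := roc P0 P1 f0 f1.

Lemma roc_in (s : R) : 0 < s < 1 -> 0 < beta s < 1.
Proof.
move=> /andP[s0 s1].
have := roc_ge hP10 hf0 hf1 (_ : 0 <= s <= 1); rewrite -/beta.
have := roc_lt1 hP01 hP10 hf0 hf1 (ltW s0) s1; rewrite -/beta.
by move=> h1 h2; rewrite h1 andbT; apply: lt_le_trans (h2 _) => //; lra.
Qed.

Lemma roc_above_diagonal s : 0 < s < 1 -> s <= beta s.
Proof. by move=> /andP[s0 s1]; apply: roc_ge hP10 hf0 hf1 _ _; lra. Qed.

(** The tie is broken by the toss of a coin, whose bias g is the position of s
    in its segment of the boundary. *)
Lemma roc_achieved (s : R) : 0 < s < 1 ->
  exists q, law P0 q letter1 = s /\ law P1 q letter1 = beta s.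
Proof.
move=> s01; have [t t0 ht] := threshold_exists hP01 hP10 hf0 hf1 s01.
have E := roc_segment hP10 hf0 hf1 (ltW t0) ht.
have exE := excess_at_least hP10 hf0 hf1 (ltW t0).
rewrite -/beta in E.
move/andP: ht => [ha hb].
set a := pr P0 (above f0 f1 t) in ha; set b := pr P0 (at_least f0 f1 t) in hb exE.
pose g := if a == b then 0 else (s - a) / (b - a).
have sE : s = g * b + (1 - g) * a.
  rewrite /g; case: eqVneq => [ab|ab].
    by rewrite mul0r subr0 mul1r add0r; apply/le_anti; rewrite ha -?ab {1}ab hb.
  by field; rewrite subr_eq0 eq_sym.
have g01 : 0 <= g <= 1.
  rewrite /g; case: eqVneq => [_|ab]; first by rewrite lexx ler01.
  have ab' : a < b by rewrite lt_neqAle ab (le_trans ha hb).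
  by rewrite divr_ge0 ?subr_ge0 ?(ltW ab')//= ler_pdivrMr ?subr_gt0// mul1r lerB.
have [q hq] := mixture_law P0 P1 (threshold_quantizer hf0 hf1 true t)
  (threshold_quantizer hf0 hf1 false t) g01.
exists q; have q0 := hq P0 (or_introl erefl); have q1 := hq P1 (or_intror erefl).
rewrite !threshold_quantizer_preimage -/a -/b in q0.
rewrite !threshold_quantizer_preimage in q1.
split; first by rewrite q0 -sE.
rewrite q1 E; move: exE; rewrite /excess -/a -/b => exE.
have -> : pr P1 (at_least f0 f1 t) = pr P1 (above f0 f1 t) - t * a + t * b by lra.
by rewrite sE; ring.
Qed.

Lemma llr_variance_bound : exists2 V, 0 <= V &
  forall q, positive_divergences P0 P1 1 q ->
    llr_variance P0 q <= V /\ llr_variance P1 q <= V.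
Proof.
have [h0 h1] := hvar; have [q1 hq1] := hne.
have bnd P : (ereal_sup [set (llr_variance P q)%:E |
    q in positive_divergences P0 P1 1] < +oo)%E -> exists V, forall q,
    positive_divergences P0 P1 1 q -> llr_variance P q <= V.
  set S := [set _ | _ in _] => hS.
  have ub q : positive_divergences P0 P1 1 q ->
      ((llr_variance P q)%:E <= ereal_sup S)%E.
    by move=> hq; apply: ereal_sup_ubound; exists q.
  have fin : ereal_sup S \is a fin_num.
    by rewrite fin_numElt hS andbT (lt_le_trans _ (ub _ hq1)) ?ltNyr.
  exists (fine (ereal_sup S)) => q hq.
  by rewrite -lee_fin fineK//; exact: ub.
have [V0 hV0] := bnd _ h0; have [V1 hV1] := bnd _ h1.
exists (Num.max 0 (Num.max V0 V1)); first by rewrite le_max lexx.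
move=> q hq; split; rewrite !le_max.
  by rewrite (hV0 _ hq) orbT.
by rewrite (hV1 _ hq) !orbT.
Qed.

(** The divergences of the quantizer at abscissa s of the boundary.  At both
    ends the output is constant; the value 0 beyond makes the functions
    continuous on the whole line. *)
Definition gain0 s : R := if 0 < s < 1 then kl s (beta s) else 0.
Definition gain1 s : R := if 0 < s < 1 then kl (beta s) s else 0.

Lemma gain0_ge0 s : 0 <= gain0 s.
Proof. by rewrite /gain0; case: ifP => // h; rewrite kl_ge0// roc_in. Qed.

Lemma gain1_ge0 s : 0 <= gain1 s.
Proof. by rewrite /gain1; case: ifP => // h; rewrite kl_ge0// roc_in. Qed.

Lemma gain_sum s : 0 < s < 1 -> gain0 s + gain1 s =
  (beta s - s) * (ln (beta s / s) - ln ((1 - beta s) / (1 - s))).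
Proof.
move=> s01; have r01 := roc_in s01.
rewrite /gain0 /gain1 s01 kl_add// (ln_ratioN (y := 1 - beta s)) //.
  by case/andP: s01 => *; lra.
by case/andP: r01 => *; lra.
Qed.

(** The likelihood ratio may be unbounded, so that it is the variance bound V
    that makes the divergences vanish at both ends of the boundary: with
    r := roc s and l the difference of the two values of the log-likelihood
    ratio, the sum of the divergences is (r - s) l, whereas
    s (1 - s) l^2 <= V and r (1 - r) l^2 <= V. *)
Lemma gain_small e : 0 < e -> exists2 c, 0 < c &
  forall s, 0 < s < 1 -> s < c \/ 1 - c < s -> gain0 s + gain1 s <= e.
Proof.
move=> e0; have [V V0 hV] := llr_variance_bound.
have key s : 0 < s < 1 ->
    s * (1 - s) * (ln (beta s / s) - ln ((1 - beta s) / (1 - s))) ^+ 2 <= V /\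
    beta s * (1 - beta s) *
      (ln (beta s / s) - ln ((1 - beta s) / (1 - s))) ^+ 2 <= V.
  move=> s01; have r01 := roc_in s01.
  have [eq|neq] := eqVneq s (beta s).
    rewrite -eq !divff ?ln1 ?subrr ?expr0n ?mulr0//.
      by case/andP: s01 => *; rewrite gt_eqF; lra.
    by case/andP: s01 => *; rewrite gt_eqF.
  have [q [q0 q1]] := roc_achieved s01.
  have hq : positive_divergences P0 P1 1 q.
    by rewrite /positive_divergences/= D0E D1E q0 q1 !kl_gt0// eq_sym.
  have h0 : P0 = P0 \/ P0 = P1 by left.
  have h1 : P1 = P0 \/ P1 = P1 by right.
  have := hV q hq; rewrite (llr_varianceE q h0) (llr_varianceE q h1) /llr.
  by rewrite (law_zero q h0) (law_zero q h1) q0 q1.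
have sq x : 0 <= x -> x ^+ 2 <= e ^+ 2 -> x <= e.
  by move=> x0; rewrite ler_pXn2r ?nnegrE// ltW.
have W0 : 0 < e ^+ 2 / (2 * V + 1) by rewrite divr_gt0 ?exprn_gt0//; lra.
set W := e ^+ 2 / (2 * V + 1) in W0.
have WE : 2 * V * W <= e ^+ 2.
  have -> : e ^+ 2 = (2 * V + 1) * W by rewrite /W; field; rewrite gt_eqF//; lra.
  by rewrite ler_wpM2r ?ltW//; lra.
pose W2 := Num.min (1 / 2) W.
have W20 : 0 < W2 by rewrite lt_min W0 andbT; lra.
have W2h : W2 <= 1 / 2 by rewrite ge_min lexx.
have W2W : W2 <= W by rewrite ge_min lexx orbT.
have [c c0 hc] := roc_small hP10 hf0 hf1 W20; rewrite -/beta in hc.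
exists (Num.min c W2); first by rewrite lt_min c0.
move=> s s01 h; have r01 := roc_in s01; have sr := roc_above_diagonal s01.
have [k0 k1] := key s s01.
apply: sq; first by rewrite addr_ge0// ?gain0_ge0 ?gain1_ge0.
rewrite gain_sum//; move: k0 k1.
set l := ln _ - ln _; set r := beta s in r01 sr * => k0 k1.
case/andP: s01 => s0 s1; case/andP: r01 => r0 r1.
have l2 : 0 <= l ^+ 2 by exact: sqr_ge0.
rewrite exprMn; case: h => [|h].
  rewrite lt_min => /andP[sc _].
  have rW : r <= W2 by apply: hc; rewrite sc ltW.
  have h1 : (r - s) ^+ 2 <= r * (2 * r * (1 - r)) by nra.
  have h2 : (r - s) ^+ 2 * l ^+ 2 <= r * (2 * r * (1 - r)) * l ^+ 2.
    by rewrite ler_wpM2r.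
  have h3 : 2 * r * (r * (1 - r) * l ^+ 2) <= 2 * r * V.
    by rewrite ler_wpM2l//; lra.
  have h4 : r * V <= W * V by rewrite ler_wpM2r//; lra.
  by lra.
have {}h : 1 - W2 < s.
  by apply: le_lt_trans h; rewrite lerD2l lerN2 ge_min lexx orbT.
have h1 : (r - s) ^+ 2 <= 2 * (1 - s) * (s * (1 - s)).
  have g1 : (r - s) ^+ 2 <= (1 - s) ^+ 2 by rewrite ler_pXn2r ?nnegrE//; lra.
  have g2 : 0 <= (2 * s - 1) * (1 - s) ^+ 2.
    by rewrite mulr_ge0 ?sqr_ge0//; lra.
  by lra.
have h2 : (r - s) ^+ 2 * l ^+ 2 <= 2 * (1 - s) * (s * (1 - s)) * l ^+ 2.
  by rewrite ler_wpM2r.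
have h3 : 2 * (1 - s) * (s * (1 - s) * l ^+ 2) <= 2 * (1 - s) * V.
  by rewrite ler_wpM2l//; lra.
have h4 : (1 - s) * V <= W * V by rewrite ler_wpM2r//; lra.
by lra.
Qed.

Lemma roc_continuous s : 0 < s < 1 -> beta x @[x --> s] --> beta s.
Proof.
move=> s01; have /andP[s0 s1] := s01; apply/cvgrPdist_le => e e0.
apply/nbhs_ballP; exists (Num.min (s / 2) (Num.min (1 - s) (e * (s / 2)))).
  by rewrite /= !lt_min; apply/and3P; split; [lra|lra|rewrite mulr_gt0//; lra].
move=> t; rewrite /ball/= !lt_min => /and3P[h1 h2 h3].
have [ts|ts] := leP t s.
  rewrite ger0_norm ?subr_ge0 // in h1 h2 h3.
  have t01 : 0 < t < 1 by lra.
  have lip := roc_lipschitz hP01 hP10 hf0 hf1 t01 ts; rewrite -/beta in lip.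
  have mono : beta t <= beta s by apply: roc_nondecreasing hP10 hf0 hf1 _ _ _ ts; lra.
  rewrite ger0_norm ?subr_ge0//; apply: (@le_trans _ _ ((s - t) / t)); first by lra.
  rewrite ler_pdivrMr; last by lra.
  apply: le_trans (ltW h3) _; rewrite ler_pM2l//; lra.
rewrite ltr0_norm ?subr_lt0 // opprB in h1 h2 h3.
have lip := roc_lipschitz hP01 hP10 hf0 hf1 s01 (ltW ts); rewrite -/beta in lip.
have mono : beta s <= beta t.
  by apply: roc_nondecreasing hP10 hf0 hf1 _ _ _ (ltW ts); lra.
rewrite distrC ger0_norm ?subr_ge0//; apply: (@le_trans _ _ ((t - s) / s)); first by lra.
rewrite ler_pdivrMr//; apply: le_trans (ltW h3) _; rewrite ler_pM2l//; lra.
Qed.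

Lemma gain_continuous_of (k : R -> R) :
  (forall s, 0 < s < 1 -> k x @[x --> s] --> k s) ->
  (forall s, 0 < s < 1 -> 0 <= k s <= gain0 s + gain1 s) ->
  continuous (fun s => if 0 < s < 1 then k s else 0).
Proof.
move=> kc kb s.
have [s01|s01] := boolP (0 < s < 1).
  rewrite /continuous_at s01; apply: cvg_trans (kc s s01); apply: near_eq_cvg.
  have /andP[s0 s1] := s01.
  near=> t.
  have -> : 0 < t < 1 => //.
  apply/andP; split; near: t; [exact: lt_nbhsr|exact: lt_nbhsl].
rewrite /continuous_at (negbTE s01); apply/cvgrPdist_le => e e0.
have [c c0 hc] := gain_small e0.
apply/nbhs_ballP; exists c => // t; rewrite /ball/= => ht.
rewrite sub0r normrN; case: ifPn => [t01|_]; last by rewrite normr0 ltW.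
have /andP[k0 k1] := kb t t01.
rewrite ger0_norm//; apply: le_trans k1 _; apply: hc => //.
move: ht; rewrite ltr_norml => /andP[h1 h2].
case/andP: t01 => t0 t1.
move: s01; rewrite negb_and -!leNgt => /orP[s0|s1]; [left|right]; lra.
Unshelve. all: by end_near. Qed.

Lemma gain0_continuous : continuous gain0.
Proof.
apply: gain_continuous_of => s s01.
  by apply: kl_cvg => //; [exact: roc_in|exact: roc_continuous].
have := gain0_ge0 s; have := gain1_ge0 s; rewrite /gain0 /gain1 s01 => *.
by apply/andP; split; lra.
Qed.

Lemma gain1_continuous : continuous gain1.
Proof.
apply: gain_continuous_of => s s01.
  by apply: kl_cvg => //; [exact: roc_in|exact: roc_continuous].
have := gain0_ge0 s; have := gain1_ge0 s; rewrite /gain0 /gain1 s01 => *.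
by apply/andP; split; lra.
Qed.

(** After a possible exchange of the two letters, which changes no divergence,
    the law (a, b) of q has a <= b; both divergences then increase with b, up
    to the boundary. *)
Lemma dominated_by_gain q : positive_divergences P0 P1 1 q ->
  exists2 s, 0 < s < 1 & D0 q <= gain0 s /\ D1 q <= gain1 s.
Proof.
move=> [d0 d1].
have dom a b : 0 <= a -> a <= b -> b <= 1 -> b <= beta a -> 0 < kl a b ->
    exists2 s, 0 < s < 1 & kl a b <= gain0 s /\ kl b a <= gain1 s.
  move=> a0 ab b1 br k0.
  have [a00|a00] := eqVneq a 0.
    suff b00 : b = 0 by move: k0; rewrite a00 b00 klxx ltxx.
    apply/le_anti; rewrite (le_trans a0 ab) andbT; apply/ler_addgt0Pr => e e0.
    have [c c0 hc] := roc_small hP10 hf0 hf1 e0.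
    by rewrite add0r; apply: le_trans br _; rewrite a00; apply: hc; rewrite lexx.
  have a0' : 0 < a by rewrite lt_neqAle eq_sym a00.
  have [a11|a11] := eqVneq a 1.
    suff b11 : b = 1 by move: k0; rewrite a11 b11 klxx ltxx.
    by apply/le_anti; rewrite b1 -a11.
  have a1' : a < 1 by rewrite lt_neqAle a11 (le_trans ab b1).
  have a01 : 0 < a < 1 by rewrite a0' a1'.
  exists a => //; rewrite /gain0 /gain1 a01; have /andP[_ r1] := roc_in a01.
  by split; [exact: kl_nondecreasing_r|exact: kl_nondecreasing_l].
have l0 u := law_le_roc hP10 hf0 hf1 q u.
have h0 : P0 = P0 \/ P0 = P1 by left.
have h1 : P1 = P0 \/ P1 = P1 by right.
move: d0 d1; rewrite D0E D1E => d0 d1.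
have [ab|ab] := leP (law P0 q letter1) (law P1 q letter1).
  apply: dom => //; [exact: law_ge0|exact: law_le1].
rewrite -klC -(klC (law P1 q letter1)) -!law_zero//; apply: dom.
- exact: law_ge0.
- by rewrite !law_zero//; lra.
- by rewrite law_zero//; have := law_ge0 P1 q letter1; lra.
- exact: l0.
- by rewrite !law_zero// klC.
Qed.

End gains.

(** * Existence of a minimal cost *)

Section minimal_cost.
Context {R : realType} (T : nat) (h0 h1 : R -> R) (c0 c1 : R).
Hypotheses (h0c : continuous h0) (h1c : continuous h1).
Hypotheses (c00 : 0 < c0) (c10 : 0 < c1).

Let H (h : R -> R) (a : 'I_T -> R) : R := \sum_t h (a t).

Lemma sum_continuous (h : R -> R) : continuous h ->
  continuous (fun a : prod_topology (fun _ : 'I_T => R) => \sum_t h (a t)).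
Proof.
move=> hc; apply: continuous_big => [|t _ a]; first exact: add_continuous.
apply: continuous_comp; last exact: hc.
exact: (@proj_continuous _ (fun _ : 'I_T => R) t).
Qed.

(** The cost blows up where the sums vanish, so it is minimized on the compact
    set where both sums are so large that neither term alone exceeds the cost
    of the constant tuple s. *)
Lemma exists_minimal_cost (s : R) :
  (0 < T)%N -> 0 <= s <= 1 -> 0 < h0 s -> 0 < h1 s ->
  exists a : 'I_T -> R, [/\ forall t, 0 <= a t <= 1, 0 < H h0 a, 0 < H h1 a &
    forall b : 'I_T -> R, (forall t, 0 <= b t <= 1) ->
      0 < H h0 b -> 0 < H h1 b ->
      c0 / H h0 a + c1 / H h1 a <= c0 / H h0 b + c1 / H h1 b].
Proof.
move=> T0 s01 s0 s1.
pose E := prod_topology (fun _ : 'I_T => R).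
pose F0 (a : E) := H h0 a; pose F1 (a : E) := H h1 a.
have F0c : continuous F0 by exact: sum_continuous.
have F1c : continuous F1 by exact: sum_continuous.
pose e : E := fun=> s.
have Fe (h : R -> R) : H h e = h s *+ T.
  by rewrite /H /e sumr_const card_ord.
have F0e : 0 < F0 e by rewrite /F0 Fe pmulrn_lgt0.
have F1e : 0 < F1 e by rewrite /F1 Fe pmulrn_lgt0.
pose G a := c0 / F0 a + c1 / F1 a.
have Ge : 0 < G e by rewrite addr_gt0 ?divr_gt0.
pose m0 := c0 / G e; pose m1 := c1 / G e.
have m00 : 0 < m0 by rewrite divr_gt0.
have m10 : 0 < m1 by rewrite divr_gt0.
have low c F : 0 < c -> 0 < F -> (c / F <= G e) = (c / G e <= F).
  by move=> c'0 F'0; rewrite !ler_pdivrMr// [in RHS]mulrC.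
pose cube := [set a : E | forall t, `[(0:R), 1]%classic (a t)].
have cubeP (a : E) : cube a <-> forall t, 0 <= a t <= 1.
  by split => h t; have := h t; rewrite /= in_itv/=.
pose K := cube `&` ([set a | m0 <= F0 a] `&` [set a | m1 <= F1 a]).
have cK : compact K.
  apply: compact_closedI.
    apply: (@tychonoff _ (fun _ : 'I_T => R) (fun _ => `[(0 : R), 1]%classic)).
    by move=> t; exact: segment_compact.
  apply: closedI.
    apply: (@preimage_closed E R F0 [set x | m0 <= x]) => [a _|]; first exact: F0c.
    exact: closed_ge.
  apply: (@preimage_closed E R F1 [set x | m1 <= x]) => [a _|]; first exact: F1c.
  exact: closed_ge.
have Kpos a : K a -> 0 < F0 a /\ 0 < F1 a.
  by move=> [_ [/= k0 k1]]; split; [exact: lt_le_trans k0|exact: lt_le_trans k1].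
have Ke : K e.
  split; first by apply/cubeP.
  split; rewrite /= -low//.
    by rewrite /G lerDl divr_ge0// ltW.
  by rewrite /G lerDr divr_ge0// ltW.
have Gc : {within K, continuous G}.
  apply: continuous_in_subspaceT => a; rewrite inE => /Kpos[k0 k1].
  have v (F : E -> R) c : continuous F -> 0 < F a ->
      (fun b : E => c / F b) @ nbhs a --> c / F a.
    move=> Fc Fa; apply: (@cvgM R E (nbhs a) _ (cst c) (fun b => (F b)^-1)).
      exact: cvg_cst.
    by apply: (@cvgV R E (nbhs a) _ F); [rewrite gt_eqF|exact: Fc].
  exact: (@cvgD _ _ E (nbhs a) _ (fun b => c0 / F0 b) (fun b => c1 / F1 b)
    _ _ (v F0 c0 F0c k0) (v F1 c1 F1c k1)).
have [] := @compact_EVT_min E R G K _ cK Gc; first by exists e.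
move=> a; rewrite inE => Ka amin; exists a; have [k0 k1] := Kpos _ Ka.
split => //; first by case: Ka => /cubeP.
move=> b b01 b0 b1; have [bK|bK] := pselect (K b).
  by apply: amin; rewrite inE.
apply: (@le_trans _ _ (G e)); first by apply: amin; rewrite inE.
have [h|h] := leP m0 (F0 b); last first.
  have : ~~ (c0 / F0 b <= G e) by rewrite low// -ltNge.
  rewrite -ltNge => /ltW h'; apply: le_trans h' _.
  by rewrite lerDl divr_ge0// ltW.
have [h'|h'] := leP m1 (F1 b).
  by exfalso; apply: bK; split; first exact/cubeP.
have : ~~ (c1 / F1 b <= G e) by rewrite low// -ltNge.
rewrite -ltNge => /ltW h''; apply: le_trans h'' _.
by rewrite lerDr divr_ge0// ltW.
Qed.

End minimal_cost.

(** * Optimal designs use threshold rules *)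

Section optimal_boundary_points.
Context {d : measure_display} {X : measurableType d} {R : realType}.
Context (mu : {measure set X -> \bar R}) (P0 P1 : probability X R).
Context (f0 f1 : X -> R).
Hypotheses (hP01 : P0 `<< P1) (hP10 : P1 `<< P0).
Hypotheses (hf0 : is_density P0 mu f0) (hf1 : is_density P1 mu f1).

Let beta := roc P0 P1 f0 f1.
Let h0 := gain0 P0 P1 f0 f1.
Let h1 := gain1 P0 P1 f0 f1.

Lemma gain_pos_or_zero x : (h0 x = 0 /\ h1 x = 0) \/
  [/\ 0 < x < 1, x < beta x, 0 < h0 x & 0 < h1 x].
Proof.
rewrite /h0 /h1 /gain0 /gain1 -/beta; case: ifPn => [x01|_]; last by left.
have b01 : 0 < beta x < 1 := roc_in hP01 hP10 hf0 hf1 x01.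
have xb : x <= beta x := roc_above_diagonal hP10 hf0 hf1 x01.
have [xE|xn] := eqVneq x (beta x); first by left; rewrite -xE klxx.
right; rewrite !kl_gt0// 1?eq_sym//.
by rewrite lt_neqAle xn xb.
Qed.

Variables (T : nat) (c0 c1 : R) (a : 'I_T -> R).
Hypotheses (c00 : 0 < c0) (c10 : 0 < c1) (a01 : forall t, 0 <= a t <= 1).
Hypotheses (a0 : 0 < \sum_t h0 (a t)) (a1 : 0 < \sum_t h1 (a t)).
Hypothesis amin : forall b : 'I_T -> R, (forall t, 0 <= b t <= 1) ->
  0 < \sum_t h0 (b t) -> 0 < \sum_t h1 (b t) ->
  c0 / (\sum_t h0 (a t)) + c1 / (\sum_t h1 (a t)) <=
  c0 / (\sum_t h0 (b t)) + c1 / (\sum_t h1 (b t)).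

Let upd (t : 'I_T) (x : R) (u : 'I_T) := if u == t then x else a u.

Let upd_sum (h : R -> R) t x :
  \sum_u h (upd t x u) = \sum_(u | u != t) h (a u) + h x.
Proof.
rewrite (bigD1 t)//= addrC /upd eqxx; congr (_ + _).
by apply: eq_bigr => u /negPf ->.
Qed.

Let sum_at (h : R -> R) t :
  \sum_u h (a u) = \sum_(u | u != t) h (a u) + h (a t).
Proof. by rewrite (bigD1 t)//= addrC. Qed.

Let upd01 t x : 0 <= x <= 1 -> forall u, 0 <= upd t x u <= 1.
Proof. by move=> x01 u; rewrite /upd; case: ifP. Qed.

(** A useless quantizer could be replaced by s. *)
Lemma minimal_gain_gt0 t s : 0 <= s <= 1 -> 0 < h0 s -> 0 < h1 s ->
  [/\ 0 < a t < 1, a t < beta (a t), 0 < h0 (a t) & 0 < h1 (a t)].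
Proof.
move=> s01 s0 s1; have [[z0 z1]|//] := gain_pos_or_zero (a t).
have := amin (upd01 t s01); rewrite !upd_sum.
move: a0 a1; rewrite !(sum_at _ t) z0 z1 !addr0.
set p := \sum_(_ | _) _; set q := \sum_(_ | _) _ => p0 q0.
have p0' : 0 < p + h0 s by rewrite addr_gt0.
have q0' : 0 < q + h1 s by rewrite addr_gt0.
move=> /(_ p0' q0'); rewrite leNgt ltrD//.
  by rewrite ltr_pM2l// ltf_pV2 ?posrE// ltrDl.
by rewrite ltr_pM2l// ltf_pV2 ?posrE// ltrDl.
Qed.

(** Otherwise a t would be inside a segment of the boundary, reached only by
    breaking the tie at random, and moving along the segment with the other
    quantizers unchanged would contradict [no_interior_minimum]. *)
Lemma minimal_at_threshold t : 0 < a t < 1 -> a t < beta (a t) ->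
  exists b s, a t = pr P0 (threshold_quantizer hf0 hf1 b s @^-1` [set letter1])
    /\ beta (a t) = pr P1 (threshold_quantizer hf0 hf1 b s @^-1` [set letter1]).
Proof.
move=> at01 atb; have [s s0 hs] := threshold_exists hP01 hP10 hf0 hf1 at01.
have seg x : pr P0 (above f0 f1 s) <= x <= pr P0 (at_least f0 f1 s) ->
    beta x = excess P0 P1 f0 f1 s + s * x.
  exact: (roc_segment hP10 hf0 hf1 (ltW s0)).
have E := seg _ hs.
have [eqa|na] := eqVneq (a t) (pr P0 (above f0 f1 s)).
  exists false, s; rewrite threshold_quantizer_preimage E; split => //.
  by rewrite /excess eqa; ring.
have [eqb|nb] := eqVneq (a t) (pr P0 (at_least f0 f1 s)).
  exists true, s; rewrite threshold_quantizer_preimage E; split => //.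
  by rewrite (excess_at_least hP10 hf0 hf1 (ltW s0)) eqb; ring.
exfalso.
set l := pr P0 (above f0 f1 s) in hs seg na *.
set r := pr P0 (at_least f0 f1 s) in hs seg nb *.
have l0 : 0 <= l by exact: pr_ge0.
have r1 : r <= 1.
  by apply: pr_le1; exact: measurable_lr_preimage hf0 hf1 _.
case/andP: hs => la ar.
have {na}la : l < a t by rewrite lt_neqAle eq_sym na.
have {nb}ar : a t < r by rewrite lt_neqAle nb.
pose k := (beta (a t) - a t) / (1 + s).
have k0 : 0 < k by rewrite divr_gt0//; lra.
pose e := Num.min k (Num.min (a t - l) (r - a t)).
have e0 : 0 < e by rewrite !lt_min k0; apply/andP; split; lra.
have small h : `|h| < e -> [/\ l < a t + h, a t + h < r & `|h| < k].
  rewrite !lt_min => /and3P[n1 n2 n3]; split => //.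
    by have := ler_norm (- h); rewrite normrN; lra.
  by have := ler_norm h; lra.
have bh h : `|h| < e -> beta (a t + h) = beta (a t) + s * h.
  by move=> /small[h2 h3 _]; rewrite E seg ?(ltW h2) ?(ltW h3)//; ring.
have in01 h : `|h| < e -> 0 < a t + h < 1.
  by move=> /small[h2 h3 _]; apply/andP; split; lra.
apply: (@no_interior_minimum R (a t) (beta (a t)) s c0 c1
  (\sum_(u | u != t) h0 (a u)) (\sum_(u | u != t) h1 (a u)) e) => //.
- by apply: sumr_ge0 => u _; exact: gain0_ge0 hP01 hP10 hf0 hf1 _.
- by apply: sumr_ge0 => u _; exact: gain1_ge0 hP01 hP10 hf0 hf1 _.
- move=> h he; have /andP[i0 i1] := in01 h he.
  have /andP[_ b1] := roc_in hP01 hP10 hf0 hf1 (in01 h he).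
  split => //; last by rewrite -bh.
  have [_ _] := small h he; rewrite /k ltr_pdivlMr; last by lra.
  have n1 := ler_norm h; have n2 := ler_norm (- h); rewrite normrN in n2.
  have : s * - h <= s * `|h| by rewrite ler_pM2l.
  by rewrite mulrDr mulr1 [`|h| * s]mulrC; lra.
move=> h he; have i01 := in01 h he.
have := amin (upd01 t (_ : 0 <= a t + h <= 1)); rewrite !upd_sum.
have -> : h0 (a t + h) = kl (a t + h) (beta (a t) + s * h).
  by rewrite /h0 /gain0 i01 -/beta bh.
have -> : h1 (a t + h) = kl (beta (a t) + s * h) (a t + h).
  by rewrite /h1 /gain1 i01 -/beta bh.
rewrite !(sum_at _ t).
have -> : h0 (a t) = kl (a t) (beta (a t)) by rewrite /h0 /gain0 at01.
have -> : h1 (a t) = kl (beta (a t)) (a t) by rewrite /h1 /gain1 at01.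
have b01 := roc_in hP01 hP10 hf0 hf1 i01.
have ne : a t + h != beta (a t) + s * h.
  rewrite lt_eqF//.
  have [_ _] := small h he; rewrite /k ltr_pdivlMr; last by lra.
  have n1 := ler_norm h.
  have n2 := ler_norm (- h); rewrite normrN in n2.
  have : s * - h <= s * `|h| by rewrite ler_pM2l.
  by rewrite mulrDr mulr1 [`|h| * s]mulrC; lra.
rewrite -/beta bh// in b01.
apply.
- by case/andP: i01 => *; apply/andP; split; exact: ltW.
- rewrite ltr_wpDl ?kl_gt0//.
  by apply: sumr_ge0 => u _; exact: gain0_ge0 hP01 hP10 hf0 hf1 _.
- rewrite ltr_wpDl ?kl_gt0 1?eq_sym//.
  by apply: sumr_ge0 => u _; exact: gain1_ge0 hP01 hP10 hf0 hf1 _.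
Qed.

End optimal_boundary_points.

Theorem corollary8 (R : realType) (d : measure_display) (X : measurableType d)
    (mu : {measure set X -> \bar R}) (P0 P1 : probability X R)
    (f0 f1 : X -> R) (pi0 pi1 : R) (T : nat)
    (hP01 : P0 `<< P1) (hP10 : P1 `<< P0)
    (hf0 : is_density P0 mu f0) (hf1 : is_density P1 mu f1)
    (hne : positive_divergences P0 P1 1 !=set0)
    (hvar : bounded_llr_variance (positive_divergences P0 P1 1))
    (hpi0 : 0 < pi0 < 1) (hpi1 : 0 < pi1 < 1) (hpi : pi0 + pi1 = 1)
    (hT : (1 <= T)%N) :
  exists phi : nat -> {mfun X >-> 'I_2},
    (forall n, likelihood_ratio_threshold_rule P0 f0 f1 (phi n)) /\
    asymptotically_optimal pi0 pi1 T
      (blockwise_stationary (positive_divergences P0 P1 1) T)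
      (fun n => deterministic P0 P1 (phi n)).
Proof.
have T0 : 0 < T%:R :> R by rewrite ltr0n.
have c00 : 0 < T%:R * pi0 by case/andP: hpi0 => *; rewrite mulr_gt0.
have c10 : 0 < T%:R * pi1 by case/andP: hpi1 => *; rewrite mulr_gt0.
have y0 : P0 = P0 \/ P0 = P1 by left.
have y1 : P1 = P0 \/ P1 = P1 by right.
have h0c := gain0_continuous hP01 hP10 hf0 hf1 hne hvar.
have h1c := gain1_continuous hP01 hP10 hf0 hf1 hne hvar.
set h0 := gain0 P0 P1 f0 f1 in h0c; set h1 := gain1 P0 P1 f0 f1 in h1c.
have [q [q0 q1]] := hne.
have [s s01 [sq0 sq1]] := dominated_by_gain hP01 hP10 hf0 hf1 (conj q0 q1).
have s0 : 0 < h0 s := lt_le_trans q0 sq0.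
have s1 : 0 < h1 s := lt_le_trans q1 sq1.
have {}s01 : 0 <= s <= 1 by case/andP: s01 => *; apply/andP; split; exact: ltW.
have [a [a01 a0 a1 amin]] := exists_minimal_cost h0c h1c c00 c10 hT s01 s0 s1.
have apos t := minimal_gain_gt0 hP01 hP10 hf0 hf1 c00 c10 a01 a0 a1 amin t s01 s0 s1.
have : forall t, exists phi : {mfun X >-> 'I_2},
    [/\ likelihood_ratio_threshold_rule P0 f0 f1 phi,
        D0 (deterministic P0 P1 phi) = h0 (a t) &
        D1 (deterministic P0 P1 phi) = h1 (a t)].
  move=> t; have [at01 atb _ _] := apos t.
  have [b [r [e0 e1]]] :=
    minimal_at_threshold hP01 hP10 hf0 hf1 c00 c10 a01 amin at01 atb.
  exists (threshold_quantizer hf0 hf1 b r); split.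
  - exact: threshold_quantizerP.
  - by rewrite D0E !law_deterministic// -e0 -e1 /h0 /gain0 at01.
  - by rewrite D1E !law_deterministic// -e0 -e1 /h1 /gain1 at01.
move=> /choice[psi hpsi].
pose phi n := psi (Ordinal (ltn_pmod n hT)).
have phiE (t : 'I_T) : phi t = psi t.
  by congr psi; apply: val_inj => /=; rewrite modn_small.
exists phi; split; first by move=> n; case: (hpsi (Ordinal (ltn_pmod n hT))).
have cE : cost_constant pi0 pi1 T (fun n => deterministic P0 P1 (phi n)) =
    T%:R * pi0 / (\sum_t h0 (a t)) + T%:R * pi1 / (\sum_t h1 (a t)).
  rewrite /cost_constant; congr (_ / _ + _ / _); apply: eq_bigr => t _;
    by rewrite phiE; have [_] := hpsi t.
split.
  split=> [n|n].
    by congr deterministic; congr psi; apply: val_inj => /=; rewrite modnDr.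
  have [_ e0 e1] := hpsi (Ordinal (ltn_pmod n hT)).
  have [_ _ p0 p1] := apos (Ordinal (ltn_pmod n hT)).
  by split; [rewrite e0|rewrite e1].
move=> design' [_ hd]; rewrite cE.
have : forall t : 'I_T, exists x, 0 <= x <= 1 /\
    (D0 (design' t) <= h0 x /\ D1 (design' t) <= h1 x).
  move=> t; have [x x01 hx] := dominated_by_gain hP01 hP10 hf0 hf1 (hd t).
  by exists x; split => //; case/andP: x01 => *; apply/andP; split; exact: ltW.
move=> /choice[b hb].
have pos (D : nat -> R) : (forall n, 0 < D n) -> 0 < \sum_(t < T) D t.
  move=> D0; rewrite -(prednK hT) big_ord_recl/=.
  by rewrite ltr_pwDl// sumr_ge0// => i _; exact: ltW.
have D0pos : 0 < \sum_(t < T) D0 (design' t).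
  by apply: (pos (fun n => D0 (design' n))) => n; case: (hd n).
have D1pos : 0 < \sum_(t < T) D1 (design' t).
  by apply: (pos (fun n => D1 (design' n))) => n; case: (hd n).
have le0 : \sum_(t < T) D0 (design' t) <= \sum_t h0 (b t).
  by apply: ler_sum => t _; case: (hb t) => _ [].
have le1 : \sum_(t < T) D1 (design' t) <= \sum_t h1 (b t).
  by apply: ler_sum => t _; case: (hb t) => _ [].
have b0 := lt_le_trans D0pos le0; have b1 := lt_le_trans D1pos le1.
apply: le_trans (amin b _ b0 b1) _; first by move=> t; case: (hb t).
by apply: lerD; rewrite ler_pM2l// lef_pV2 ?posrE.
Qed.
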